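(* Let $p,q$ be coprime integers with $0<q<p$, and let $n\in\{1,\ldots,p-1\}$. The invariant $I(L_n(p,q))$ is explicitly given by $$I(L_n(p,q))=-\frac{1}{s_n^2\,t_n^2\,p^2},$$ where $$s_n=nq_n^*-p\,\nu_n,\qquad t_n=p-s_n=p(\nu_n+1)-nq_n^*,$$ $$\nu_n=\frac1p\sum_{k=0}^{p-1}\frac{1-\zeta^{k(1-n)}}{1-\zeta^k}\,\frac{1-\zeta^{kq(q_n^*-1)}}{1-\zeta^{-kq}},\qquad \zeta=e^{2\pi i/p},$$ and $q_n^*\in\{1,\ldots,p-1\}$ is such that $qq_n^*\equiv n \bmod p$.
   Context: Convention for the sum: the indeterminate term with $k=0$ in $\nu_n$ is understood as its limit, $(n-1)(q_n^*-1)$. A zero denominator in the formula for $I$ is read as the value infinity, meaning that the complex below is not acyclic ($\det f_3=0$). Triangulated lens space $L_n(p,q)$. Take a bipyramid with upper and lower apex both called $D$, whose equator is a $2p$-gon with vertices in cyclic order $B_1,C_1,B_2,C_2,\ldots,B_p,C_p$ (indices modulo $p$; $B_{i+1}$, $C_{i+1}$ are obtained from $B_i$, $C_i$ by rotation through $2\pi/p$), and with central point $A$. It is divided into $4p$ tetrahedra, the cones with vertex $A$ over the $2p$ upper and $2p$ lower triangles $BCD$ of its surface. The lens space $L(p,q)$ is obtained by gluing each upper surface triangle to the lower surface triangle that is below it after rotation through $2\pi q/p$, so that the upper triangles $B_iC_iD$, $C_iB_{i+1}D$ are glued to the lower triangles $B_{i+q}C_{i+q}D$, $C_{i+q}B_{i+q+1}D$.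 All $B_i$ become one vertex $B$, all $C_i$ one vertex $C$, the apexes one vertex $D$. The resulting $4p+4$ edges are: $(AB)_i=AB_i$, $(AC)_i=AC_i$, $(BD)_i$ and $(CD)_i$ the upper edges $B_iD$ and $C_iD$ ($i=1,\ldots,p$; they are glued to the lower edges $B_{i+q}D$, $C_{i+q}D$), $(AD)_1$ and $(AD)_2$ the upper and lower edges $AD$, $(BC)_1$ the common class of all $B_iC_i$ and $(BC)_2$ the common class of all $C_iB_{i+1}$. $L_n(p,q)$ denotes this triangulated lens space with the distinguished chain consisting of the two upper tetrahedra $AB_iC_iD$ with $i=n$ and $i=p$ (at angular distance $n\cdot 2\pi/p$). They share the edges $(AD)_1$ and $(BC)_1$, and the $10$ edges of the chain are $(AB)_i,(CD)_i,(AC)_i,(BD)_i$ for $i=n,p$ and $(AD)_1,(BC)_1$. All tetrahedra are consistently oriented so that the distinguished ones have orientation $BACD$. The chain represents a framed knot going along the element $n\in\mathbb Z_p=H_1(L(p,q))$. Geometry. The vertices $A,B,C,D$ are assigned points of $\mathbb R^3$ not lying in one plane. $l_a$ is the length of edge $a$; oriented volume: $6V_{MNRQ}=\overrightarrow{MN}\cdot\overrightarrow{MQ}\cdot\overrightarrow{MR}$ (scalar triple product). Every dihedral angle of a tetrahedron, computed from its edge lengths, is taken with the sign of the oriented volume of the (oriented) tetrahedron. The deficit angle at an edge $a$ is $\omega_a=-\sum_i\varphi_i\bmod2\pi$, the sum being over the signed dihedral angles at $a$ of all tetrahedra containing $a$. The $\omega_a$ are functions of independently varied edge lengths, and partial derivatives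 are taken at the lengths coming from the placement in $\mathbb R^3$. Invariant. Call inner the edges not belonging to the distinguished chain, and let $f_3=(\partial\omega_a/\partial l_b)$ with $a,b$ running over inner edges. As there are no vertices besides $A,B,C,D$, the complex used is $0\to(dl)'\xrightarrow{f_3}(d\omega)'\to0$ (spaces spanned by differentials of lengths of, resp. deficit angles at, inner edges), with torsion $\tau=1/\det f_3$, and $$I=\tau\,\frac{\prod'_{\rm edges}l^2}{\prod'_{\rm tetrahedra}(-6V)}(6V_{ABCD})^4,$$ where the first product is over inner edges and the second over all tetrahedra except the two distinguished ones, with oriented volumes $V$. The numbers $s_n,t_n$. Let $G_3=6V_{ABCD}\,\bigl(l_a^{-1}\,\partial\omega_a/\partial l_b\,l_b^{-1}\bigr)$ with $a,b$ running over all edges; $S_1$ is its $p\times p$ block with rows $(AB)_i$ and columns $(CD)_j$, and $S_2$ its $p\times p$ block with rows $(AC)_i$ and columns $(BD)_j$. $s_n$ (resp. $t_n$) is by definition the determinant of the $(p-2)\times(p-2)$ matrix obtained from $S_1$ (resp. $S_2$) by removing the $n$th and $p$th rows and columns (the determinant of a $0\times0$ matrix being $1$); the theorem includes the assertion that these determinants are given by the formulas $s_n=nq_n^*-p\,\nu_n$ and $t_n=p-s_n=p(\nu_n+1)-nq_n^*$, where $\nu_n=\frac1p\sum_{k=0}^{p-1}\frac{1-\zeta^{k(1-n)}}{1-\zeta^k}\,\frac{1-\zeta^{kq(q_n^*-1)}}{1-\zeta^{-kq}}$ with $\zeta=e^{2\pi i/p}$, and $q_n^*\in\{1,\ldots,p-1\}$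 satisfies $qq_n^*\equiv n\bmod p$. *)

(* Defs.v *)
From HB Require Import structures.
From mathcomp Require Import all_boot all_order all_algebra.
From mathcomp Require Import all_classical all_reals all_analysis.
From mathcomp Require Import complex.

Set Implicit Arguments.
Unset Strict Implicit.
Unset Printing Implicit Defensive.

Import Order.TTheory GRing.Theory Num.Theory.

Local Open Scope ring_scope.

Inductive vertex := vA | vB | vC | vD.

Inductive kind := kAB | kAC | kAD | kBC | kBD | kCD.

Definition ends (k : kind) : vertex * vertex :=
  match k with
  | kAB => (vA, vB) | kAC => (vA, vC) | kAD => (vA, vD)
  | kBC => (vB, vC) | kBD => (vB, vD) | kCD => (vC, vD)
  end.

(* The 4p + 4 edges of the triangulated lens space.  Indices are modulo p, so
   that the index p is 0; for 1 < p the type 'Z_p has exactly p elements.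
   eBD i and eCD i are the upper edges B_i D and C_i D, eAD1 and eAD2 the upper
   and lower edges AD, eBC1 the class of the B_i C_i, eBC2 that of the
   C_i B_(i+1). *)
Inductive edge (p : nat) :=
  | eAB of 'Z_p | eAC of 'Z_p | eBD of 'Z_p | eCD of 'Z_p
  | eAD1 | eAD2 | eBC1 | eBC2.
Arguments eAD1 {p}.
Arguments eAD2 {p}.
Arguments eBC1 {p}.
Arguments eBC2 {p}.

Section EdgeFinite.
Variable p : nat.

Definition edge_code (a : edge p) :
    (('Z_p + 'Z_p) + ('Z_p + 'Z_p)) + (bool + bool) :=
  match a with
  | eAB i => inl (inl (inl i)) | eAC i => inl (inl (inr i))
  | eBD i => inl (inr (inl i)) | eCD i => inl (inr (inr i))
  | eAD1 => inr (inl true) | eAD2 => inr (inl false)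
  | eBC1 => inr (inr true) | eBC2 => inr (inr false)
  end.

Definition edge_decode
    (c : (('Z_p + 'Z_p) + ('Z_p + 'Z_p)) + (bool + bool)) : edge p :=
  match c with
  | inl (inl (inl i)) => eAB i | inl (inl (inr i)) => eAC i
  | inl (inr (inl i)) => eBD i | inl (inr (inr i)) => eCD i
  | inr (inl true) => eAD1 | inr (inl false) => eAD2
  | inr (inr true) => eBC1 | inr (inr false) => eBC2
  end.

Lemma edge_codeK : cancel edge_code edge_decode.
Proof. by case. Qed.

HB.instance Definition _ := Finite.copy (edge p) (can_type edge_codeK).

End EdgeFinite.

Definition edge_kind (p : nat) (a : edge p) : kind :=
  match a with
  | eAB _ => kAB | eAC _ => kAC | eBD _ => kBD | eCD _ => kCD
  | eAD1 | eAD2 => kAD | eBC1 | eBC2 => kBC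
  end.

(* The tetrahedron (up, one, i) is the cone with vertex A over the upper (up)
   or lower (~~ up) surface triangle B_i C_i D (one) or C_i B_(i+1) D
   (~~ one). *)
Definition tetra (p : nat) : finType := (bool * bool * 'Z_p)%type.

(* The upper edges B_i D, C_i D are glued to the lower edges B_(i+q) D,
   C_(i+q) D, hence the index shift by - q in a lower tetrahedron. *)
Definition tet_edge (p q : nat) (t : tetra p) (k : kind) : edge p :=
  let: (up, one, i) := t in
  let iB : 'Z_p := if one then i else i + 1 in
  let iC : 'Z_p := i in
  let shift : 'Z_p := if up then 0 else q%:R in
  match k with
  | kAB => eAB iB
  | kAC => eAC iC
  | kAD => if up then eAD1 else eAD2
  | kBC => if one then eBC1 else eBC2
  | kBD => eBD (iB - shift)
  | kCD => eCD (iC - shift)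
  end.

Definition tet_has (p q : nat) (t : tetra p) (a : edge p) : bool :=
  tet_edge q t (edge_kind a) == a.

(* The two tetrahedra of the distinguished chain: upper A B_i C_i D with
   i = n and i = p. *)
Definition distinguished (p n : nat) : {set tetra p} :=
  [set (true, true, n%:R); (true, true, p%:R)].

Definition inner_edges (p q n : nat) : {set edge p} :=
  [set a | [forall t in distinguished p n, ~~ tet_has q t a]].

Section Geometry.
Variable R : realType.

Definition dot (u v : 'rV[R]_3) : R := \sum_(k < 3) u 0 k * v 0 k.

Definition coplanar (P : vertex -> 'rV[R]_3) : Prop :=
  exists (u : 'rV[R]_3) (c : R), u != 0 /\ forall v, dot u (P v) = c.

(* Euclidean distance; the norm that the library puts on 'rV[R]_3 is the
   maximum norm. *)
Definition dist (x y : 'rV[R]_3) : R := Num.sqrt (dot (x - y) (x - y)).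

Definition triple (u v w : 'rV[R]_3) : R :=
  \det (\matrix_(i < 3, j < 3) nth 0 [:: u; v; w] i 0 j).

(* 6 V_(MNRQ), the triple product of MN, MQ, MR in this order. *)
Definition vol6 (P : vertex -> 'rV[R]_3) (m n r s : vertex) : R :=
  triple (P n - P m) (P s - P m) (P r - P m).

(* All tetrahedra are oriented consistently with the orientation BACD of the
   upper A B_i C_i D: crossing a face A C D, A B D or A B C exchanges two
   vertices. *)
Definition tet_vol6 (P : vertex -> 'rV[R]_3) (p : nat) (t : tetra p) : R :=
  let: (up, one, _) := t in
  if up == one then vol6 P vB vA vC vD else vol6 P vA vB vC vD.

(* Dihedral angle at the edge MN of a tetrahedron MNRQ, from its six edge
   lengths.  By polarization, gnr, gnq and grq are the inner products of the
   vectors MN, MR, MQ; up to the common factor mn ^+ 2, the three expressions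
   under acos are the inner product and the squared norms of the components of
   MR and MQ orthogonal to MN. *)
Definition dihedral (mn mr mq nr nq rq : R) : R :=
  let gnr := (mn ^+ 2 + mr ^+ 2 - nr ^+ 2) / 2 in
  let gnq := (mn ^+ 2 + mq ^+ 2 - nq ^+ 2) / 2 in
  let grq := (mr ^+ 2 + mq ^+ 2 - rq ^+ 2) / 2 in
  acos ((mn ^+ 2 * grq - gnr * gnq) /
        (Num.sqrt (mn ^+ 2 * mr ^+ 2 - gnr ^+ 2) *
         Num.sqrt (mn ^+ 2 * mq ^+ 2 - gnq ^+ 2))).

Definition dihedral_at (L : kind -> R) (k : kind) : R :=
  match k with
  | kAB => dihedral (L kAB) (L kAC) (L kAD) (L kBC) (L kBD) (L kCD)
  | kAC => dihedral (L kAC) (L kAB) (L kAD) (L kBC) (L kCD) (L kBD)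
  | kAD => dihedral (L kAD) (L kAB) (L kAC) (L kBD) (L kCD) (L kBC)
  | kBC => dihedral (L kBC) (L kAB) (L kBD) (L kAC) (L kCD) (L kAD)
  | kBD => dihedral (L kBD) (L kAB) (L kBC) (L kAD) (L kCD) (L kAC)
  | kCD => dihedral (L kCD) (L kAC) (L kBC) (L kAD) (L kBD) (L kAB)
  end.

(* Deficit angle at a as a function of all edge lengths.  The orientation signs
   are those of the placement P, near which the lengths are varied.  The deficit
   angle is this number modulo 2 pi; only its derivatives are used, and the
   derivative of a function with values in R / 2 pi Z is that of a lift. *)
Definition omega (P : vertex -> 'rV[R]_3) (p q : nat) (l : edge p -> R)
    (a : edge p) : R :=
  - \sum_(t : tetra p | tet_has q t a)
      Num.sg (tet_vol6 P t) * dihedral_at (l \o tet_edge q t) (edge_kind a).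

Definition placed_length (P : vertex -> 'rV[R]_3) (p : nat) (a : edge p) : R :=
  let: (u, v) := ends (edge_kind a) in dist (P u) (P v).

Definition partial (p : nat) (f : (edge p -> R) -> R) (l : edge p -> R)
    (b : edge p) : R :=
  derive1 (fun x : R => f (fun c => if c == b then x else l c)) (l b).

Definition domega (P : vertex -> 'rV[R]_3) (p q : nat) (a b : edge p) : R :=
  partial (fun l => omega P q l a) (@placed_length P p) b.

(* Determinant of a square matrix whose rows and columns are both indexed by
   the elements of A; independent of the enumeration of A. *)
Definition det_on (T : finType) (A : {set T}) (f : T -> T -> R) : R :=
  \det (\matrix_(i < #|A|, j < #|A|) f (enum_val i) (enum_val j)).

(* The quotient x / y for x != 0; None is the unsigned value infinity. *)
Definition quotient_or_infinity (x y : R) : option R :=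
  if y == 0 then None else Some (x / y).

Definition det_f3 (P : vertex -> 'rV[R]_3) (p q n : nat) : R :=
  det_on (inner_edges p q n) (domega P q).

Definition torsion (P : vertex -> 'rV[R]_3) (p q n : nat) : option R :=
  quotient_or_infinity 1 (det_f3 P p q n).

Definition lens_invariant (P : vertex -> 'rV[R]_3) (p q n : nat) : option R :=
  omap (fun tau : R =>
    tau * ((\prod_(a in inner_edges p q n) placed_length P a ^+ 2) /
           (\prod_(t : tetra p | t \notin distinguished p n)
              (- tet_vol6 P t))) *
    vol6 P vA vB vC vD ^+ 4) (torsion P p q n).

Definition G3 (P : vertex -> 'rV[R]_3) (p q : nat) (a b : edge p) : R :=
  vol6 P vA vB vC vD *
    ((placed_length P a)^-1 * domega P q a b * (placed_length P b)^-1).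

Definition kept_indices (p n : nat) : {set 'Z_p} := ~: [set n%:R; p%:R].

Definition s_num (P : vertex -> 'rV[R]_3) (p q n : nat) : R :=
  det_on (kept_indices p n) (fun i j => G3 P q (eAB i) (eCD j)).

Definition t_num (P : vertex -> 'rV[R]_3) (p q n : nat) : R :=
  det_on (kept_indices p n) (fun i j => G3 P q (eAC i) (eBD j)).

Definition zeta (p : nat) : R[i] :=
  Complex (cos (2 * pi / p%:R)) (sin (2 * pi / p%:R)).

(* The exponents are integers, possibly negative.  The term k = 0 is the limit
   of the general one for k -> 0. *)
Definition nu (p q n qs : nat) : R[i] :=
  (p%:R)^-1 *
  \sum_(k < p)
    if k == 0 :> nat then (n%:R - 1) * (qs%:R - 1)
    else (1 - zeta p ^ (k%:Z * (1 - n%:Z))) / (1 - zeta p ^ k%:Z) *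
         ((1 - zeta p ^ (k%:Z * q%:Z * (qs%:Z - 1))) /
          (1 - zeta p ^ (- (k%:Z * q%:Z)))).

End Geometry.

(* Main.v *)
Require Import Defs.
From HB Require Import structures.
From mathcomp Require Import all_boot all_order all_fingroup all_algebra.
From mathcomp Require Import all_classical all_reals all_analysis.
From mathcomp Require Import complex ring lra zify fintype finset.

Set Implicit Arguments.
Unset Strict Implicit.
Unset Printing Implicit Defensive.

Import Order.TTheory GRing.Theory Num.Theory.

Local Open Scope ring_scope.

(** All 4p tetrahedra have the same four vertices in space, so up to the sign
of the orientation they all carry one and the same tetrahedron ABCD of oriented
volume V.  The derivative of the deficit angle at [a] along the edge [b] is
therefore, up to the sign of V, a derivative of a dihedral angle of ABCD times
the signed number [incidence] of the tetrahedra that contain both [a] and [b],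
its multiplicity.  If [a] and [b] lie over edges of ABCD with a common vertex, some face
of ABCD contains both, and crossing the faces of that type pairs the
tetrahedra through [a] and [b] into couples of opposite orientation: the
multiplicity is zero ([incidence_eq0]).  If they lie over opposite edges, the
derivative of the dihedral angle is l_a l_b / 6|V|
([is_derive_dihedral_opposite]).  Altogether the derivative is
l_a l_b / 6V_ABCD times an integer ([domegaE]), and [G3] is the matrix of these
integers ([G3E]).

Hence the matrix of f_3 splits into three symmetric pairings: AB with CD, AC
with BD, and AD with BC.  The first two have as half-blocks the circulants
(1 - E)(1 - E^q) and (1 - E^-1)(1 - E^q), E being the cyclic shift, with the
rows and columns n and p deleted; the third is the number p.  So
det f_3 = - s^2 t^2 p^2 up to powers of lengths and of V ([pdet_inner],
[det_f3E]), and these powers cancel in the invariant ([lens_invariantE]).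

It remains to delete two rows and two columns of a circulant whose eigenvalue
at the trivial character is zero and whose other eigenvalues are g_k.  The
determinant is the product of the g_k, divided by p^2, times the sum of
|1 - chi_k(n)|^2 / g_k ([circ_delete2], from [pdet_delete2]).  Here the product
is p^2, because the numbers 1 - zeta^k with 0 < k < p have product p, and the
sum is a Fourier-Dedekind sum ([lens_sum]).  The relation
1 / (1 - x) + 1 / (1 - x^-1) = 1 between roots of unity x <> 1 gives t = p - s
([lens_sumN]), and also expands the sum that defines nu_n into geometric sums
and the Fourier-Dedekind sum of s ([sum_chi_nu], [p_mul_nu]). *)

(** * Determinants over finite index sets *)

(** [det_on] over an arbitrary commutative ring: the determinants are real, but
    are computed over the complex numbers. *)
Definition pdet (R : comPzRingType) (T : finType) (A : {set T})
    (f : T -> T -> R) : R :=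
  \det (\matrix_(i < #|A|, j < #|A|) f (enum_val i) (enum_val j)).

Section PrincipalDet.
Variable R : comPzRingType.
Implicit Types (T : finType).

(** Two enumerations differ by a permutation, which acts on rows and columns
    alike, so that its sign occurs twice. *)
Lemma pdet_enum T (A : {set T}) m (e : 'I_m -> T) (f : T -> T -> R) :
    injective e -> (forall x, (x \in A) = (x \in codom e)) ->
  pdet A f = \det (\matrix_(i < m, j < m) f (e i) (e j)).
Proof.
move=> e_inj eA; have Em : m = #|A|.
  by rewrite (eq_card eA) card_codom ?card_ord.
subst m; have eAi i : e i \in A by rewrite eA codom_f.
pose g i := enum_rank_in (eAi i) (e i).
have gK i : enum_val (g i) = e i by rewrite enum_rankK_in.
have g_inj : injective g by move=> i j Eij; apply: e_inj; rewrite -!gK Eij.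
pose s := perm g_inj; set M := (X in _ = \det X).
suff -> : M = row_perm s (col_perm s
    (\matrix_(i < #|A|, j < #|A|) f (enum_val i) (enum_val j))).
  rewrite row_permE col_permE !det_mulmx !det_perm odd_permV mulrCA.
  by rewrite -signr_addb addbb mulr1.
by apply/matrixP=> i j; rewrite !mxE !permE !gK.
Qed.

Lemma eq_pdet T (A : {set T}) (f g : T -> T -> R) :
  {in A &, f =2 g} -> pdet A f = pdet A g.
Proof.
by move=> fg; congr (\det _); apply/matrixP=> i j; rewrite !mxE fg ?enum_valP.
Qed.

Lemma pdetT n (f : 'I_n -> 'I_n -> R) :
  pdet [set: 'I_n] f = \det (\matrix_(i, j) f i j).
Proof.
rewrite (@pdet_enum _ _ _ id) // => x; rewrite inE.
by symmetry; apply/codomP; exists x.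
Qed.

Lemma pdet1 T (A : {set T}) : pdet A (fun x y => (x == y)%:R : R) = 1.
Proof.
rewrite -[RHS](det1 R #|A|); congr (\det _).
by apply/matrixP=> i j; rewrite !mxE (inj_eq enum_val_inj).
Qed.

Lemma pdet_scale T (A : {set T}) (c d : T -> R) (f : T -> T -> R) :
  pdet A (fun x y => c x * f x y * d y) =
  \prod_(x in A) c x * pdet A f * \prod_(x in A) d x.
Proof.
rewrite [\prod_(x in A) c x]big_enum_val [\prod_(x in A) d x]big_enum_val.
pose diag (h : T -> R) := diag_mx (\row_(i < #|A|) h (enum_val i)).
have det_diag_h h : \det (diag h) = \prod_(i < #|A|) h (enum_val i).
  by rewrite det_diag; apply: eq_bigr => i _; rewrite mxE.
rewrite -(det_diag_h c) -(det_diag_h d) -!det_mulmx; congr (\det _).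
by apply/matrixP=> i j; rewrite mul_mx_diag mul_diag_mx !mxE.
Qed.

Definition enumU T (A B : {set T}) (i : 'I_(#|A| + #|B|)) : T :=
  match split i with inl j => enum_val j | inr j => enum_val j end.

Lemma enumU_inj T (A B : {set T}) :
  [disjoint A & B] -> injective (@enumU T A B).
Proof.
move=> dAB i j; rewrite /enumU -{2}(splitK i) -{2}(splitK j).
case: (split i) => u; case: (split j) => v E /=.
- by rewrite (enum_val_inj E).
- by have := disjointFr dAB (enum_valP u); rewrite E enum_valP.
- by have := disjointFl dAB (enum_valP u); rewrite E enum_valP.
- by rewrite (enum_val_inj E).
Qed.

Lemma enumU_codom T (A B : {set T}) x :
  (x \in A :|: B) = (x \in codom (@enumU T A B)).
Proof.
apply/idP/codomP => [/setUP[] xAB|[i ->]].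
- exists (lshift _ (enum_rank_in xAB x)).
  by rewrite /enumU (unsplitK (inl _)) enum_rankK_in.
- exists (rshift _ (enum_rank_in xAB x)).
  by rewrite /enumU (unsplitK (inr _)) enum_rankK_in.
by rewrite inE /enumU; case: (split i) => j; rewrite enum_valP ?orbT.
Qed.

Lemma pdetU T (A B : {set T}) (f : T -> T -> R) :
    [disjoint A & B] -> {in A & B, forall x y, f x y = 0} ->
  pdet (A :|: B) f = pdet A f * pdet B f.
Proof.
move=> dAB f0.
rewrite (pdet_enum _ (enumU_inj dAB) (@enumU_codom _ A B)).
set M := (X in \det X); rewrite -[M]submxK.
have -> : ursubmx M = 0.
  apply/matrixP=> i j; rewrite !mxE /enumU.
  by rewrite (unsplitK (inl _)) (unsplitK (inr _)) f0 ?enum_valP.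
rewrite det_lblock; congr (_ * _); congr (\det _); apply/matrixP=> i j.
  by rewrite !mxE /enumU !(unsplitK (inl _)).
by rewrite !mxE /enumU !(unsplitK (inr _)).
Qed.

Lemma det_antidiag_block n (B C : 'M[R]_n) :
  \det (block_mx 0 B C 0) = (-1) ^+ n * (\det B * \det C).
Proof.
(* the last three factors multiply to the exchange of the two blocks *)
have -> : block_mx 0 B C 0 = block_mx B 0 0 C *m (block_mx 1%:M 0 1%:M 1%:M
    *m (block_mx 1%:M (-1)%:M 0 1%:M *m block_mx 1%:M 0 1%:M (-1)%:M)).
  rewrite !mulmx_block !(mulmx0, mul0mx, addr0, add0r, mulmx1, mul1mx).
  rewrite -!scalar_mxM.
  have inv0 : 1%:M + (-1)%:M = 0 :> 'M[R]_n by rewrite -raddfD subrr raddf0.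
  by rewrite mulrNN mulr1 inv0 add0r !mulmx0 !mulmx1.
rewrite !det_mulmx !det_lblock !det_ublock !det1 !det_scalar !mulr1 !mul1r.
by rewrite mulrC.
Qed.

Lemma pdet_bipartite T (I : finType) (h1 h2 : I -> T) (K : {set I})
    (f : T -> T -> R) :
    injective h1 -> injective h2 -> (forall i j, h1 i != h2 j) ->
    (forall i j, f (h1 i) (h1 j) = 0) -> (forall i j, f (h2 i) (h2 j) = 0) ->
    (forall i j, f (h2 i) (h1 j) = f (h1 j) (h2 i)) ->
  pdet (h1 @: K :|: h2 @: K) f =
    (-1) ^+ #|K| * pdet K (fun i j => f (h1 i) (h2 j)) ^+ 2.
Proof.
move=> h1I h2I h12 f11 f22 f21; set k := #|K|.
pose e (i : 'I_(k + k)) :=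
  match split i with inl j => h1 (enum_val j) | inr j => h2 (enum_val j) end.
rewrite (@pdet_enum _ _ _ e); first last.
- move=> x; apply/idP/codomP => [/setUP[]/imsetP[u uK ->]|[i ->]].
  + exists (lshift _ (enum_rank_in uK u)).
    by rewrite /e (unsplitK (inl _)) enum_rankK_in.
  + exists (rshift _ (enum_rank_in uK u)).
    by rewrite /e (unsplitK (inr _)) enum_rankK_in.
  + by rewrite inE /e; case: (split i) => j; rewrite imset_f ?enum_valP ?orbT.
- move=> i j; rewrite /e -{2}(splitK i) -{2}(splitK j).
  case: (split i) => u; case: (split j) => v Euv.
  + by rewrite (enum_val_inj (h1I _ _ Euv)).
  + by have := h12 (enum_val u) (enum_val v); rewrite Euv eqxx.
  + by have := h12 (enum_val v) (enum_val u); rewrite Euv eqxx.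
  + by rewrite (enum_val_inj (h2I _ _ Euv)).
rewrite expr2 -{2}[pdet K _]det_tr -det_antidiag_block; congr (\det _).
have eL u : e (lshift _ u) = h1 (enum_val u) by rewrite /e (unsplitK (inl _)).
have eR u : e (rshift _ u) = h2 (enum_val u) by rewrite /e (unsplitK (inr _)).
apply/matrixP=> i j; rewrite -(splitK i) -(splitK j).
case: (split i) => u; case: (split j) => v;
  rewrite /= ?(block_mxEul, block_mxEur, block_mxEdl, block_mxEdr) !mxE;
  by rewrite ?eL ?eR.
Qed.

Lemma pdet_complement n (A : {set 'I_n}) (f : 'I_n -> 'I_n -> R) :
  pdet A f = \det (\matrix_(i, j) if i \in A then f i j else (i == j)%:R).
Proof.
rewrite -(pdetT (fun i j => if i \in A then f i j else (i == j)%:R)).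
rewrite -(setUCr A) setUC pdetU; first last.
- move=> x y; rewrite inE => /negPf xA yA; rewrite xA.
  by case: eqP yA xA => // -> ->.
- by rewrite disjoint_sym disjoints_subset setCK.
rewrite -[LHS]mul1r; congr (_ * _).
  apply: (etrans (esym (pdet1 _))); apply: eq_pdet => x y.
  by rewrite inE => /negPf xA _; rewrite xA.
by apply: eq_pdet => x y xA yA /=; rewrite xA.
Qed.

End PrincipalDet.

Lemma map_pdet (R S : comPzRingType) (h : {rmorphism R -> S}) (T : finType)
    (A : {set T}) (f : T -> T -> R) :
  h (pdet A f) = pdet A (fun x y => h (f x y)).
Proof.
by rewrite -det_map_mx; congr (\det _); apply/matrixP=> i j; rewrite !mxE.
Qed.

(** * Deleting two rows and columns *)

Lemma det_mx2 (R : comPzRingType) (M : 'M[R]_2) :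
  \det M = M 0 0 * M 1 1 - M 0 1 * M 1 0.
Proof.
rewrite (expand_det_row _ 0) !big_ord_recl big_ord0 /cofactor !det_mx11 !mxE.
rewrite !expr0 !expr1 !mul1r addr0 mulN1r mulrN.
by congr (_ * M _ _ - M _ _ * M _ _); apply/val_inj.
Qed.

Lemma det_ones_border (R : comPzRingType) m :
  \det (\matrix_(i < m.+1, j < m.+1)
     if j == 0 then 1 else (i == j)%:R - (i == 0)%:R : R) = m.+1%:R.
Proof.
set Z := (X in \det X).
(* adding to the first column minus the sum of the others leaves only the entry
   1 + m in it *)
pose U : 'M[R]_(1 + m) := block_mx 1%:M 0 (const_mx (-1)) 1%:M.
have detU : \det U = 1 by rewrite det_lblock !det1 mulr1.
pose B : 'M[R]_(1 + m) := block_mx 1%:M (const_mx (-1)) (const_mx 1) 1%:M.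
have -> : Z = B.
  apply: (etrans (esym (@submxK _ 1 m 1 m Z))).
  congr (@block_mx _ _ _ _ _ _ _ _ _); apply/matrixP=> i j.
  - by rewrite !ord1 !mxE.
  - by rewrite !ord1 !mxE /= add0r.
  - by rewrite !ord1 !mxE.
  - by rewrite !mxE /= subr0 (inj_eq (@rshift_inj 1 m)).
transitivity (\det (B *m U)); first by rewrite det_mulmx detU mulr1.
rewrite mulmx_block.
rewrite !(mulmx1, mul1mx, mulmx0, mul0mx, add0r, addr0).
have -> : const_mx 1 + const_mx (-1) = 0 :> 'M[R]_(m, 1).
  by apply/matrixP=> i j; rewrite !mxE subrr.
rewrite det_ublock det1 mulr1 (mx11_scalar (_ + _)) det_scalar1.
rewrite !mxE eqxx /= (eq_bigr (fun=> 1)) => [|k _].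
  by rewrite sumr_const card_ord addrC natr1.
by rewrite !mxE mulrNN mulr1.
Qed.

(** Let M' be M with the rows b and 0 replaced by unit rows, so that det M' is
    the determinant on the left.  As T inverts M up to the constant vectors, M
    sends T (e_j - e_0) to e_j - e_0 and the constant vector to 0.  In the basis
    of these vectors (the columns of T *m Z, with Z as in [det_ones_border]) M'
    is therefore block triangular, with a 2 x 2 block at b and 0 as the only
    block other than the identity. *)
Lemma pdet_delete2 (F : fieldType) m (M T : 'M[F]_m.+1) (b : 'I_m.+1) :
    b != 0 -> M *m T = 1%:M - const_mx (m.+1%:R)^-1 ->
    M *m const_mx 1 = 0 :> 'cV_m.+1 ->
    T *m const_mx 1 = const_mx 1 :> 'cV_m.+1 ->
  pdet (~: [set b; 0]) (fun i j => M i j) * (\det T * m.+1%:R) =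
    T b b - T b 0 - T 0 b + T 0 0.
Proof.
move=> b0 MT M1 T1; rewrite pdet_complement -det_ones_border -!det_mulmx.
set M' := (X in \det (X *m _)); set Z := (X in _ *m (_ *m X)).
have TZ0 i : (T *m Z) i 0 = 1.
  transitivity ((T *m (const_mx 1 : 'cV_m.+1)) i 0); last by rewrite T1 mxE.
  by rewrite !mxE; apply: eq_bigr => k _; rewrite !mxE eqxx.
have sum_delta i l : \sum_k T i k * (k == l)%:R = T i l.
  rewrite (bigD1 l) //= eqxx mulr1 big1 ?addr0 // => k /negPf ->.
  by rewrite mulr0.
have TZj i j : j != 0 -> (T *m Z) i j = T i j - T i 0.
  move=> j0; rewrite !mxE.
  rewrite (eq_bigr (fun k => T i k * (k == j)%:R - T i k * (k == 0)%:R)).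
    by rewrite sumrB !sum_delta.
  by move=> k _; rewrite !mxE (negPf j0) mulrBr.
have in_del i : (i \in ~: [set b; 0]) = (i != b) && (i != 0).
  by rewrite !inE negb_or.
have del_row i j : i \notin ~: [set b; 0] ->
    (M' *m (T *m Z)) i j = (T *m Z) i j.
  move=> iK; rewrite mxE (bigD1 i) //= [M' _ _]mxE (negPf iK) eqxx mul1r.
  rewrite big1 ?addr0 // => k ki.
  by rewrite [M' _ _]mxE (negPf iK) eq_sym (negPf ki) mul0r.
have keep_row i j : i \in ~: [set b; 0] ->
    (M' *m (T *m Z)) i j = (M *m (T *m Z)) i j.
  by move=> iK; rewrite !mxE; apply: eq_bigr => k _; rewrite [M' _ _]mxE iK.
have MTZ i j : i \in ~: [set b; 0] -> (M *m (T *m Z)) i j = (i == j)%:R.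
  rewrite in_del => /andP[_ i0]; have [->|j0] := eqVneq j 0.
    rewrite (negPf i0); transitivity ((M *m (const_mx 1 : 'cV_m.+1)) i 0).
      by rewrite !mxE; apply: eq_bigr => k _; rewrite TZ0 mxE.
    by rewrite M1 mxE.
  transitivity ((M *m T) i j - (M *m T) i 0).
    by rewrite !mxE -sumrB; apply: eq_bigr => k _; rewrite TZj // mulrBr.
  by rewrite MT !mxE (negPf i0) /=; ring.
set X := M' *m (T *m Z).
have -> : \det X = pdet [set: 'I_m.+1] (fun i j => X i j).
  by rewrite pdetT; congr (\det _); apply/matrixP=> i j; rewrite [RHS]mxE.
rewrite -(setUCr (~: [set b; 0])) pdetU; first last.
- move=> i j iK; rewrite setCK keep_row // MTZ //; move: iK; rewrite in_del.
  by rewrite !inE => /andP[/negPf ib /negPf i0] /orP[]/eqP->; rewrite ?ib ?i0.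
- by rewrite disjoints_subset setCK.
have -> : pdet (~: [set b; 0]) (fun i j => X i j) = 1.
  by rewrite -[RHS](pdet1 F (~: [set b; 0])); apply: eq_pdet => i j iK _;
    rewrite keep_row // MTZ.
rewrite mul1r setCK.
rewrite (@pdet_enum _ _ _ 2 (fun i => if i == 0 then b else 0)); first last.
- move=> x; rewrite !inE; apply/idP/codomP => [/orP[]/eqP ->|[i ->]].
  + by exists 0.
  + by exists 1.
  + by case: ifP; rewrite eqxx ?orbT.
- move=> i j; case: i => [[|[|i]] Hi] //; case: j => [[|[|j]] Hj] // E;
    apply: val_inj => //=; move: E b0; rewrite /= -?val_eqE /=.
  + by move=> ->; rewrite eqxx.
  + by move=> <-; rewrite eqxx.
have b_del : b \notin ~: [set b; 0] by rewrite !inE eqxx.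
have z_del : 0 \notin ~: [set b; 0] by rewrite !inE eqxx orbT.
have [Xb0 X00] : X b 0 = 1 /\ X 0 0 = 1 by rewrite /X !del_row // !TZ0.
have [Xbb X0b] : X b b = T b b - T b 0 /\ X 0 b = T 0 b - T 0 0.
  by rewrite /X !del_row // !TZj.
clearbody X; rewrite det_mx2 !mxE /= Xb0 X00 Xbb X0b.
ring.
Qed.

(** * Fourier analysis on Z/p *)

Lemma natZp_neq0 m n : (0 < n < m.+2)%N -> n%:R != 0 :> 'Z_m.+2.
Proof.
case/andP=> n0 np; rewrite -val_eqE /= val_Zp_nat //= modn_small //.
by rewrite -lt0n.
Qed.

Section Fourier.
Variables (F : numFieldType) (m : nat) (z : F).
Local Notation p := m.+2.
Hypothesis z_prim : p.-primitive_root z.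

Let p_neq0 : p%:R != 0 :> F. Proof. by rewrite pnatr_eq0. Qed.

Definition chi (k : 'Z_p) : F := z ^+ k.

Lemma chi0 : chi 0 = 1. Proof. by []. Qed.

Lemma chiD j k : chi (j + k) = chi j * chi k.
Proof. by rewrite /chi -exprD /= (prim_expr_mod z_prim). Qed.

Lemma chiMn k n : chi (k *+ n) = chi k ^+ n.
Proof. by elim: n => [|n IH]; rewrite ?mulr0n ?chi0 // mulrS chiD IH exprS. Qed.

Lemma chiN k : chi (- k) = (chi k)^-1.
Proof.
have: chi k * chi (- k) = 1 by rewrite -chiD subrr chi0.
by move=> E; apply/esym/mulr1_eq.
Qed.

Lemma chi_neq0 k : chi k != 0.
Proof.
apply/eqP => E; have := chiD k (- k); rewrite subrr chi0 E mul0r.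
by move/eqP; rewrite oner_eq0.
Qed.

Lemma chi_eq1 k : (chi k == 1) = (k == 0).
Proof.
rewrite /chi -(prim_order_dvd z_prim) -val_eqE /=.
by rewrite /dvdn modn_small // ltn_ord.
Qed.

Lemma sum_chi (k : 'Z_p) :
  \sum_(j : 'Z_p) chi (k * j) = if k == 0 then p%:R else 0.
Proof.
case: eqVneq => [->|k0].
  rewrite (eq_bigr (fun=> 1)) ?sumr_const ?card_ord //.
set S := (LHS); suff: (chi k - 1) * S = 0.
  by move/eqP; rewrite mulf_eq0 subr_eq0 chi_eq1 (negPf k0) /= => /eqP.
rewrite mulrBl mul1r mulr_sumr; apply/eqP; rewrite subr_eq0; apply/eqP.
rewrite /S.
rewrite [RHS](reindex_inj (addIr 1)) /=; apply: eq_bigr => j _.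
by rewrite mulrDr mulr1 chiD mulrC.
Qed.

(** The circulant matrix with eigenvalue g_k on the character k. *)
Definition circ (g : 'Z_p -> F) : 'M[F]_p :=
  \matrix_(i, j) (p%:R^-1 *
    \sum_(k : 'Z_p) g k * chi (k * ((i : 'Z_p) - (j : 'Z_p)))).

Definition fourier : 'M[F]_p := \matrix_(i, k) chi ((k : 'Z_p) * (i : 'Z_p)).
Definition fourier_inv : 'M[F]_p :=
  p%:R^-1 *: \matrix_(k, j) chi (- ((k : 'Z_p) * (j : 'Z_p))).

Lemma fourierK : fourier_inv *m fourier = 1%:M.
Proof.
apply/matrixP=> k l; rewrite !mxE.
rewrite (eq_bigr
    (fun j : 'Z_p => p%:R^-1 * chi (((l : 'Z_p) - (k : 'Z_p)) * j))).
  rewrite -mulr_sumr sum_chi subr_eq0 eq_sym.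
  by case: eqP => _; rewrite ?mulr0 // mulVf.
by move=> j _; rewrite !mxE -mulrA -chiD; congr (_ * chi _); ring.
Qed.

Lemma circE g : circ g = fourier *m diag_mx (\row_k g k) *m fourier_inv.
Proof.
apply/matrixP=> i j; rewrite mul_mx_diag !mxE mulr_sumr; apply: eq_bigr => k _.
rewrite !mxE mulrBr chiD; ring.
Qed.

Lemma circM g h : circ g *m circ h = circ (fun k => g k * h k).
Proof.
rewrite !circE -!mulmxA (mulmxA fourier_inv) fourierK mul1mx.
rewrite (mulmxA (diag_mx _)).
congr (_ *m (_ *m _)); rewrite mulmx_diag; congr diag_mx.
by apply/rowP=> k; rewrite !mxE.
Qed.

Lemma det_circ g : \det (circ g) = \prod_k g k.
Proof.
rewrite circE !det_mulmx det_diag mulrAC -det_mulmx (mulmx1C fourierK) det1.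
rewrite mul1r.
by apply: eq_bigr => k _; rewrite mxE.
Qed.

Lemma circ_ones g : circ g *m const_mx 1 = const_mx (g 0) :> 'cV_p.
Proof.
apply/colP=> i; rewrite !mxE.
transitivity (p%:R^-1 * \sum_(k : 'Z_p)
    g k * chi (k * (i : 'Z_p)) * \sum_(j : 'Z_p) chi (- k * j)).
  transitivity (p%:R^-1 *
      \sum_(k : 'Z_p) \sum_(j : 'Z_p) g k * chi (k * ((i : 'Z_p) - j))).
    rewrite exchange_big mulr_sumr; apply: eq_bigr => j _.
    by rewrite !mxE mulr1.
  congr (_ * _); apply: eq_bigr => k _; rewrite mulr_sumr.
  by apply: eq_bigr => j _; rewrite -mulrA -chiD mulrBr mulNr.
rewrite (bigD1 0) //= sum_chi oppr0 eqxx mul0r chi0 mulr1.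
rewrite [X in _ + X]big1 ?addr0 => [|k k0].
  by rewrite mulrCA mulVf // mulr1.
by rewrite sum_chi oppr_eq0 (negPf k0) mulr0.
Qed.

Lemma circ_const : circ (fun=> 1) = 1%:M.
Proof.
apply/matrixP=> i j; rewrite !mxE; under eq_bigr do rewrite mul1r mulrC.
rewrite sum_chi subr_eq0; by case: eqP => _; rewrite ?mulr0 // mulVf.
Qed.

(** The circulant [h] with eigenvalue 1 at the trivial character and 1 / g_k
    elsewhere inverts that of g up to the constant vectors.  The right-hand sum
    is the entry combination of [pdet_delete2] for [h], since
    2 - chi_k(b) - chi_k(-b) = (1 - chi_k(b)) (1 - chi_k(-b)). *)
Lemma circ_delete2 (g : 'Z_p -> F) (b : 'Z_p) :
    b != 0 -> g 0 = 0 -> (forall k, k != 0 -> g k != 0) ->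
  pdet (~: [set b; 0]) (fun i j => circ g i j) * p%:R ^+ 2 =
  (\prod_(k | k != 0) g k) *
  \sum_(k | k != 0) (1 - chi (k * b)) * (1 - chi (- (k * b))) / g k.
Proof.
move=> b0 g0 gn0; pose h k := if k == 0 then 1 else (g k)^-1.
have detT : \det (circ h) = (\prod_(k | k != 0) g k)^-1.
  rewrite det_circ (bigD1 0) //= /h eqxx mul1r -prodfV.
  by apply: eq_bigr => k /negPf ->.
have MT : circ g *m circ h = 1%:M - const_mx (m.+2%:R)^-1.
  rewrite circM -circ_const; apply/matrixP=> i j; rewrite !mxE.
  rewrite -[X in _ = _ - X]mulr1 -mulrBr; congr (_ * _).
  rewrite [in RHS](bigD1 0) //= [in LHS](bigD1 0) //= g0 !mul0r add0r.
  rewrite chi0 mulr1 addrAC subrr add0r.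
  by apply: eq_bigr => k k0; rewrite /h (negPf k0) divff ?gn0.
have M1 : circ g *m const_mx 1 = 0 :> 'cV_p.
  by rewrite circ_ones g0; apply/colP=> i; rewrite !mxE.
have T1 : circ h *m const_mx 1 = const_mx 1 :> 'cV_p.
  by rewrite circ_ones /h eqxx.
have := pdet_delete2 b0 MT M1 T1; rewrite detT => E.
have P0 : \prod_(k | k != 0) g k != 0 by apply/prodf_neq0.
set G := \prod_(k | k != 0) g k in E P0 *; set D := pdet _ _ in E *.
have -> : D * p%:R ^+ 2 = G * p%:R * (D * (G^-1 * p%:R)) by field.
rewrite E -mulrA; congr (_ * _).
rewrite !mxE -!mulrBr -mulrDr mulVKf // -!sumrB -big_split /= (bigD1 0) //=.
rewrite !mul0r chi0 subrr sub0r addNr add0r; apply: eq_bigr => k k0.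
have E1 : chi (k * b) * chi (- (k * b)) = 1 by rewrite -chiD subrr chi0.
rewrite /h (negPf k0) !subrr subr0 sub0r mulr0 chi0 mulrN.
rewrite mulrBl mulrBr !mul1r mulrBr mulr1 E1; ring.
Qed.

Lemma unit_mul_eq0 (c k : 'Z_p) :
  c \is a GRing.unit -> (k * c == 0) = (k == 0).
Proof. by move=> cU; rewrite -[RHS](inj_eq (mulIr cU)) mul0r. Qed.

Lemma chi_unit_neq1 (c k : 'Z_p) :
  c \is a GRing.unit -> k != 0 -> 1 - chi (k * c) != 0.
Proof. by move=> cU k0; rewrite subr_eq0 eq_sym chi_eq1 unit_mul_eq0. Qed.

(** Up to reindexing, the value at 1 of (X^p - 1) / (X - 1). *)
Lemma prod_1_sub_chi (c : 'Z_p) : c \is a GRing.unit ->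
  \prod_(k | k != 0) (1 - chi (k * c)) = p%:R.
Proof.
move=> cU; transitivity (\prod_(k : 'Z_p | k != 0) (1 - chi k)).
  rewrite [RHS](reindex_inj (mulIr cU)) /=.
  by apply: eq_bigl => k; rewrite unit_mul_eq0.
have := factor_Xn_sub_1 z_prim; rewrite subrX1 big_mkord (bigD1 ord0) //=.
have -> : z ^+ 0 = 1 by [].
move/(mulfI (negbT (polyXsubC_eq0 _))) => E.
have := congr1 (fun P => P.[1]) E; rewrite /= horner_prod horner_sum => {}E.
transitivity (\prod_(i < p | i != ord0) ('X - (z ^+ i)%:P).[1]).
  by apply: eq_bigr => i _; rewrite !hornerE.
rewrite E (eq_bigr (fun=> 1)) ?sumr_const ?card_ord // => i _.
by rewrite !hornerE expr1n.
Qed.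

(** Each term is a geometric sum over 0 <= j < n; summed over k != 0 first, its
    powers with j > 0 contribute -1 each and the one with j = 0 contributes
    p - 1. *)
Lemma sum_chi_geom (c : 'Z_p) n : c \is a GRing.unit -> (0 < n < p)%N ->
  \sum_(k | k != 0) (1 - chi (k * c) ^+ n) / (1 - chi (k * c)) = p%:R - n%:R.
Proof.
move=> cU /andP[n0 np].
transitivity (\sum_(k : 'Z_p | k != 0) \sum_(j < n) chi (c *+ j * k)).
  apply: eq_bigr => k k0; rewrite -(opprB _ 1) subrX1 -mulNr opprB mulrAC.
  rewrite divff ?chi_unit_neq1 // mul1r; apply: eq_bigr => j _.
  by rewrite -chiMn mulrnAl mulrC.
rewrite exchange_big /=.
transitivity (\sum_(j < n) ((if val j == 0%N then p%:R else 0) - 1 : F)).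
  apply: eq_bigr => j _; have := sum_chi (c *+ j).
  rewrite (bigD1 0) //= mulr0 chi0.
  have -> : (c *+ j == 0) = (val j == 0%N).
    rewrite -mulr_natl unit_mul_eq0 // -val_eqE /= val_Zp_nat //=.
    by rewrite modn_small // (leq_ltn_trans _ np) // ltnW.
  by move=> <-; rewrite addrAC subrr add0r.
rewrite sumrB sumr_const card_ord; congr (_ - _).
by case: n n0 np => // n _ _; rewrite big_ord_recl /= big1 ?addr0.
Qed.

(** The numerators are invariant under k -> -k, while 1 / (1 - x) and
    1 / (1 - x^-1) add up to 1; so twice the sum is the sum of the
    numerators. *)
Lemma sum_chi_gap (b c : 'Z_p) : c \is a GRing.unit -> b != 0 ->
  \sum_(k | k != 0)
     (1 - chi (k * b)) * (1 - chi (- (k * b))) / (1 - chi (k * c)) = p%:R.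
Proof.
move=> cU b0; set S := LHS.
have SN : S = \sum_(k | k != 0)
    (1 - chi (k * b)) * (1 - chi (- (k * b))) / (1 - (chi (k * c))^-1).
  rewrite /S (reindex_inj oppr_inj) /=; apply: eq_big => k.
    by rewrite oppr_eq0.
  by move=> _; rewrite !mulNr opprK -chiN [X in X / _]mulrC.
have two_neq0 : 2 != 0 :> F by rewrite pnatr_eq0.
apply: (mulfI two_neq0); rewrite mulr_natl mulr2n {2}SN -big_split /=.
transitivity (\sum_(k : 'Z_p) (2 - chi (b * k) - chi (- b * k))).
  rewrite [RHS](bigD1 0) //= !mulr0 chi0 [X in _ = X + _](_ : _ = 0) ?add0r;
    last by ring.
  apply: eq_bigr => k k0; have := chi_unit_neq1 cU k0.
  set w := chi (k * c) => w1.
  have w0 : w != 0 by apply: chi_neq0.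
  have E1 : chi (b * k) * chi (- b * k) = 1 by rewrite -chiD mulNr subrr chi0.
  transitivity ((1 - chi (b * k)) * (1 - chi (- b * k))).
    rewrite mulNr ![b * k]mulrC; field; rewrite w0 w1.
    by rewrite -oppr_eq0 opprB w1.
  by rewrite mulrBl mulrBr !mul1r mulrBr mulr1 E1; ring.
rewrite !sumrB !sum_chi oppr_eq0 (negPf b0) !subr0 sumr_const card_ord.
by rewrite mulr_natr.
Qed.

(** The Fourier-Dedekind sum that computes s_n for a = 1 and t_n for a = -1,
    with b = q. *)
Definition lens_sum (n a b : 'Z_p) : F :=
  \sum_(k | k != 0) (1 - chi (k * n)) * (1 - chi (- (k * n))) /
     ((1 - chi (k * a)) * (1 - chi (k * b))).

(** With x = chi_k, w = chi_k^q and u = x^n = w^r, the two factors are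
    1/u + (1 - 1/u) / (1 - x) and u + (1 - u) / (1 - 1/w).  As
    1 / (1 - 1/w) = 1 - 1 / (1 - w), their product is
    1 - (1 - 1/u) / (1 - 1/w) - (1 - u) / (1 - x) + N / (1 - x)
    - N / ((1 - x) (1 - w)) with N = (1 - u) (1 - 1/u), and all terms but the
    last have known sums. *)
Lemma sum_chi_nu (q : 'Z_p) (n r : nat) :
    q \is a GRing.unit -> (0 < n < p)%N -> (0 < r < p)%N -> q * r%:R = n%:R ->
  \sum_(k | k != 0)
     (1 - chi k / chi k ^+ n) / (1 - chi k) *
     ((1 - chi (k * q) ^+ r / chi (k * q)) / (1 - (chi (k * q))^-1)) =
  n%:R + r%:R - 1 - lens_sum n%:R 1 q.
Proof.
move=> qU np rp qr; have n0 := natZp_neq0 np.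
have E1 := sum_chi_geom (unitr1 _) np.
have qNU : - q \is a GRing.unit by rewrite unitrN.
have E2 := sum_chi_geom qNU rp.
have E3 := sum_chi_gap (unitr1 _) n0.
have E4 : \sum_(k : 'Z_p | k != 0) (1 : F) = p%:R - 1.
  have := sumr_const 'Z_p (1 : F); rewrite card_ord => /esym ->.
  by rewrite [in RHS](bigD1 0) //= addrAC subrr add0r.
have -> : n%:R + r%:R - 1 =
    (p%:R - 1) - (p%:R - r%:R) - (p%:R - n%:R) + p%:R :> F by ring.
rewrite -E4 -E1 -E2 -{1}E3 -!sumrB -big_split -sumrB /=.
apply: eq_bigr => k k0.
have w1 := chi_unit_neq1 qU k0; have z1 := chi_unit_neq1 (unitr1 _) k0.
have wr : chi (k * q) ^+ r = chi k ^+ n.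
  by rewrite -!chiMn -mulr_natr -mulrA qr mulr_natr.
rewrite mulr1 in z1; rewrite !mulr1 mulrN !chiN exprVn wr mulr_natr chiMn.
set u := chi k ^+ n; set w := chi (k * q) in w1 *; set x := chi k in z1 *.
have u0 : u != 0 by rewrite /u expf_neq0 ?chi_neq0.
have w0 : w != 0 by apply: chi_neq0.
by field; rewrite u0 w0 w1 z1 /= -oppr_eq0 opprB w1.
Qed.

Lemma circ_diff2 (a b i j : 'Z_p) :
  circ (fun k => (1 - chi (- (k * a))) * (1 - chi (- (k * b)))) i j =
  (i == j)%:R - (i == j + a)%:R - (i == j + b)%:R + (i == j + a + b)%:R.
Proof.
have delta x y : (x == y :> 'Z_p)%:R =
    p%:R^-1 * \sum_(k : 'Z_p) chi ((x - y) * k).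
  by rewrite sum_chi subr_eq0; case: eqP => _; rewrite ?mulr0 // mulVf.
rewrite !delta -!mulrBr -mulrDr mxE -!sumrB -big_split /=; congr (_ * _).
apply: eq_bigr => k _.
have -> : (i - (j + a)) * k = k * (i - j) - k * a by ring.
have -> : (i - (j + b)) * k = k * (i - j) - k * b by ring.
have -> : (i - (j + a + b)) * k = k * (i - j) - k * a - k * b by ring.
by rewrite [(i - j) * k]mulrC !chiD; ring.
Qed.

Lemma pdet_diff2 (n a b : 'Z_p) :
    n != 0 -> a \is a GRing.unit -> b \is a GRing.unit ->
  pdet (~: [set n; 0]) (fun i j : 'Z_p =>
    (i == j)%:R - (i == j + a)%:R - (i == j + b)%:R
    + (i == j + a + b)%:R : F) =
  lens_sum n a b.
Proof.
move=> n0 aU bU.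
set g := fun k : 'Z_p => (1 - chi (- (k * a))) * (1 - chi (- (k * b))).
have g0 : g 0 = 0 by rewrite /g !mul0r oppr0 chi0 subrr mul0r.
have gn0 k : k != 0 -> g k != 0.
  by move=> k0; rewrite /g mulf_neq0 // -mulrN chi_unit_neq1 ?unitrN.
have prod_g : \prod_(k | k != 0) g k = p%:R ^+ 2.
  rewrite big_split expr2 /=; congr (_ * _).
    rewrite -(@prod_1_sub_chi (- a)) ?unitrN //.
    by apply: eq_bigr => k _; rewrite mulrN.
  rewrite -(@prod_1_sub_chi (- b)) ?unitrN //.
  by apply: eq_bigr => k _; rewrite mulrN.
have p20 : p%:R ^+ 2 != 0 :> F by rewrite expf_neq0.
apply: (mulIf p20); rewrite -prod_g [RHS]mulrC prod_g.
rewrite (eq_pdet (g := fun i j => circ g i j)); last first.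
  by move=> i j _ _; rewrite circ_diff2.
rewrite circ_delete2 // prod_g /lens_sum; congr (_ * _).
rewrite (reindex_inj oppr_inj) /=; apply: eq_big => k.
  by rewrite oppr_eq0.
by move=> _; rewrite /g !mulNr !opprK; congr (_ / _); rewrite mulrC.
Qed.

Lemma lens_sumN (n b : 'Z_p) : n != 0 -> b \is a GRing.unit ->
  lens_sum n (- 1) b = p%:R - lens_sum n 1 b.
Proof.
move=> n0 bU; apply/eqP; rewrite -subr_eq0 opprB addrA subr_eq0; apply/eqP.
rewrite -(sum_chi_gap bU n0) /lens_sum -big_split /=; apply: eq_bigr => k k0.
have z1 := chi_unit_neq1 (unitr1 _) k0; rewrite mulr1 in z1.
have z0 := chi_neq0 k; have w1 := chi_unit_neq1 bU k0.
rewrite mulrN mulr1 (chiN k); field.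
by rewrite z0 w1 z1 /= -oppr_eq0 opprB z1.
Qed.

End Fourier.

(** * The root of unity and the number nu *)

Section Zeta.
Variable R : realType.

Lemma zeta_exp p k :
  zeta R p ^+ k = Complex (cos (2 * pi / p%:R *+ k)) (sin (2 * pi / p%:R *+ k)).
Proof.
elim: k => [|k IH]; first by rewrite !mulr0n cos0 sin0.
rewrite exprS IH /zeta; set x := 2 * pi / _; rewrite mulrS cosD sinD.
by apply/eqP; rewrite eq_complex /= eqxx /= addrC eqxx.
Qed.

Lemma zeta_prim p : (0 < p)%N -> p.-primitive_root (zeta R p).
Proof.
move=> p0; have p0R : p%:R != 0 :> R by rewrite pnatr_eq0 -lt0n.
have zp : zeta R p ^+ p = 1.
  rewrite zeta_exp -[_ *+ p]mulr_natr divfK // mulr_natl cos2pi sin_mulr2n.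
  by rewrite sinpi mulr0 mul0rn.
have [d d_prim d_dvd] := prim_order_exists p0 zp.
have d0 := prim_order_gt0 d_prim.
have := dvdn_leq p0 d_dvd; rewrite leq_eqVlt => /predU1P[E|dp].
  by rewrite -{1}E.
(* the angle of zeta ^+ d is 2 y with 0 < y < pi *)
have := prim_expr_order d_prim; rewrite zeta_exp.
have -> : 2 * pi / p%:R *+ d = (pi * (d%:R / p%:R)) *+ 2 :> R.
  by rewrite -mulr_natr -[RHS]mulr_natl; ring.
set y := pi * _ => -[cosy _].
have siny : 0 < sin y.
  apply: sin_gt0_pi; rewrite /y mulr_gt0 ?pi_gt0 ?divr_gt0 ?ltr0n //=.
  by rewrite gtr_pMr ?pi_gt0 // ltr_pdivrMr ?ltr0n // mul1r ltr_nat dp.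
have := cos2Dsin2 y; move: cosy; rewrite cos_mulr2n => cosy E.
have : 0 < sin y ^+ 2 by rewrite exprn_gt0.
by lra.
Qed.

Variables (m : nat).
Local Notation p := m.+2.
Local Notation z := (zeta R p).

Lemma natC_neq0 k : k.+1%:R != 0 :> R[i].
Proof. by rewrite pnatr_eq0. Qed.

Lemma p_mul_nu (q n r : nat) :
    coprime p q -> (0 < n < p)%N -> (0 < r < p)%N -> q * r = n %[mod p] ->
  p%:R * nu R p q n r = n%:R * r%:R - lens_sum z (n%:R : 'Z_p) 1 q%:R.
Proof.
move=> pq np rp qr; have zP := zeta_prim (ltn0Sn m.+1).
have qU : (q%:R : 'Z_p) \is a GRing.unit by rewrite unitZpE.
have qrZ : q%:R * r%:R = n%:R :> 'Z_p.
  by rewrite -natrM; apply: val_inj; rewrite /= !val_Zp_nat.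
have E := sum_chi_nu zP qU np rp qrZ.
have -> : n%:R * r%:R - lens_sum z (n%:R : 'Z_p) 1 q%:R =
    (n%:R - 1) * (r%:R - 1) +
    (n%:R + r%:R - 1 - lens_sum z (n%:R : 'Z_p) 1 q%:R) by ring.
rewrite -E /nu mulVKf ?natC_neq0 // (bigD1 ord0) //=; congr (_ + _).
apply: eq_bigr => k k0; rewrite -val_eqE /= in k0; rewrite (negPf k0).
have z0 : z != 0 by exact: (chi_neq0 zP 1).
have -> : chi z (k * q%:R) = z ^ (k%:Z * q%:Z).
  by rewrite mulr_natr chiMn // -PoszM -exprnP exprM.
have zk : chi z k = z ^ k%:Z by [].
rewrite zk !exprnP !exprz_exp !invr_expz -!expfzDr //.
by congr ((1 - z ^ _) / _ * ((1 - z ^ _) / _)); ring.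
Qed.

Lemma real_lens_sum (n : nat) (a b : 'Z_p) :
    (0 < n < p)%N -> a \is a GRing.unit -> b \is a GRing.unit ->
  (pdet (kept_indices p n) (fun i j : 'Z_p =>
    (i == j)%:R - (i == j + a)%:R - (i == j + b)%:R
    + (i == j + a + b)%:R : R))%:C%C =
  lens_sum z (n%:R : 'Z_p) a b.
Proof.
move=> /natZp_neq0 n0 aU bU; have zP := zeta_prim (ltn0Sn m.+1).
rewrite -(pdet_diff2 zP n0 aU bU) /kept_indices pchar_Zp // [LHS]map_pdet.
by apply: eq_pdet => i j _ _ /=; rewrite rmorphD !rmorphB /= !rmorph_nat.
Qed.

End Zeta.

(** * Signed incidence of edges *)

Definition opposite (k : kind) : kind :=
  match k with
  | kAB => kCD | kAC => kBD | kAD => kBC | kBC => kAD | kBD => kAC | kCD => kAB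
  end.

Lemma common_face (k k' : kind) : k' <> opposite k ->
  exists v, [/\ v <> (ends k).1, v <> (ends k).2,
    v <> (ends k').1 & v <> (ends k').2].
Proof.
by case: k; case: k' => //= _;
  (exists vA; split => //; fail) || (exists vB; split => //; fail) ||
  (exists vC; split => //; fail) || (exists vD; split => //; fail).
Qed.

Section Incidence.
Variables (R : realType) (p q : nat).

(** The sign of the oriented volume relative to that of BACD. *)
Definition tet_sign (t : tetra p) : R := if t.1.1 == t.1.2 then 1 else -1.

Definition incidence (a b : edge p) : R :=
  \sum_(t : tetra p | tet_has q t a && tet_has q t b) tet_sign t.

(** The neighbour of [t] across its face opposite to [v]. *)
Definition cross (v : vertex) (t : tetra p) : tetra p :=
  let: (up, one, i) := t in
  match v with
  | vA => (~~ up, one, if up then i + q%:R else i - q%:R)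
  | vB => (up, ~~ one, i)
  | vC => (up, ~~ one, if one then i - 1 else i + 1)
  | vD => (~~ up, one, i)
  end.

Lemma crossK v : involutive (cross v).
Proof.
by case: v => [] [[[] []] i] //=; rewrite ?(addrK, subrK).
Qed.

Lemma tet_sign_cross v t : tet_sign (cross v t) = - tet_sign t.
Proof. by case: v t => [] [[[] []] i]; rewrite /tet_sign /= ?opprK. Qed.

Lemma tet_edge_cross v t k : v <> (ends k).1 -> v <> (ends k).2 ->
  tet_edge q (cross v t) k = tet_edge q t k.
Proof.
case: v t => [] [[[] []] i]; case: k => /= h1 h2;
  try (by case: h1); try (by case: h2);
  clear h1 h2; move: (1 : 'Z_p) => d; rewrite ?subr0;
  first [ reflexivity
        | congr (eAB _); ring | congr (eBD _); ring | congr (eCD _); ring ].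
Qed.

(** Crossing the faces over a face of ABCD that contains both edges exchanges
    the tetrahedra through [a] and [b] of the two orientations. *)
Lemma incidence_eq0 a b :
  edge_kind b <> opposite (edge_kind a) -> incidence a b = 0.
Proof.
move=> /common_face[v [a1 a2 b1 b2]].
suff: incidence a b = - incidence a b.
  by move/eqP; rewrite -subr_eq0 opprK -mulr2n mulrn_eq0 => /eqP.
rewrite {1}/incidence (reindex_inj (inv_inj (crossK v))) -sumrN /=.
apply: eq_big => t; first by rewrite /tet_has !tet_edge_cross.
by rewrite tet_sign_cross.
Qed.

Lemma incidenceC a b : incidence a b = incidence b a.
Proof. by apply: eq_bigl => t; rewrite andbC. Qed.

Lemma eAB_eq i j : (eAB i == eAB j :> edge p) = (i == j).
Proof. by apply/eqP/eqP => [[->]|->]. Qed.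
Lemma eAC_eq i j : (eAC i == eAC j :> edge p) = (i == j).
Proof. by apply/eqP/eqP => [[->]|->]. Qed.
Lemma eBD_eq i j : (eBD i == eBD j :> edge p) = (i == j).
Proof. by apply/eqP/eqP => [[->]|->]. Qed.
Lemma eCD_eq i j : (eCD i == eCD j :> edge p) = (i == j).
Proof. by apply/eqP/eqP => [[->]|->]. Qed.

Lemma incidenceE a b : incidence a b =
  \sum_(up : bool) \sum_(one : bool) (if up == one then 1 else -1) *
     \sum_(i : 'Z_p) (tet_has q (up, one, i) a && tet_has q (up, one, i) b)%:R.
Proof.
pose F (x : bool * bool) (i : 'Z_p) : R :=
  (if x.1 == x.2 then 1 else -1) *
  (tet_has q (x, i) a && tet_has q (x, i) b)%:R.
transitivity (\sum_(t : tetra p) F t.1 t.2).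
  rewrite /incidence big_mkcond; apply: eq_bigr => -[x i] _.
  by rewrite /F /tet_sign /=; case: ifP => _; rewrite ?mulr1 ?mulr0.
rewrite -(pair_bigA _ F) [RHS]pair_bigA /=; apply: eq_bigr => -[up one] _.
by rewrite mulr_sumr.
Qed.

Lemma sum_two_eqs (P Q : pred 'Z_p) x y :
    P =1 pred1 x -> Q =1 pred1 y ->
  \sum_(k : 'Z_p) (P k && Q k)%:R = (x == y)%:R :> R.
Proof.
move=> Px Qy; rewrite (bigD1 x) //= Px Qy /= eqxx big1 ?addr0 //.
by move=> k /negPf kx; rewrite Px /= kx.
Qed.

Lemma addr_eq_sub (x y z : 'Z_p) : (x + y == z) = (x == z - y).
Proof. by rewrite [RHS]eq_sym subr_eq eq_sym. Qed.

Lemma incidence_AB_CD i j : incidence (eAB i) (eCD j) =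
  (i == j)%:R - (i == j + 1)%:R - (i == j + q%:R)%:R + (i == j + 1 + q%:R)%:R.
Proof.
rewrite incidenceE !big_bool /= !mul1r !mulN1r /tet_has /=.
move: (1 : 'Z_p) (q%:R : 'Z_p) => d s.
have B0 : (fun k => eAB k == eAB i) =1 pred1 i by move=> k; rewrite eAB_eq.
have B1 : (fun k => eAB (k + d) == eAB i) =1 pred1 (i - d).
  by move=> k; rewrite eAB_eq addr_eq_sub.
have C u : (fun k => eCD (k - u) == eCD j) =1 pred1 (j + u).
  by move=> k; rewrite eCD_eq subr_eq.
rewrite (sum_two_eqs B0 (C 0)) (sum_two_eqs B1 (C 0)).
rewrite (sum_two_eqs B0 (C s)) (sum_two_eqs B1 (C s)) !subr_eq addr0.
by rewrite (addrAC j s d); ring.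
Qed.

Lemma incidence_AC_BD i j : incidence (eAC i) (eBD j) =
  (i == j)%:R - (i == j + - 1)%:R - (i == j + q%:R)%:R
  + (i == j + - 1 + q%:R)%:R.
Proof.
rewrite incidenceE !big_bool /= !mul1r !mulN1r /tet_has /=.
move: (1 : 'Z_p) (q%:R : 'Z_p) => d s.
have C0 : (fun k => eAC k == eAC i) =1 pred1 i by move=> k; rewrite eAC_eq.
have B0 u : (fun k => eBD (k - u) == eBD j) =1 pred1 (j + u).
  by move=> k; rewrite eBD_eq subr_eq.
have B1 u : (fun k => eBD (k + d - u) == eBD j) =1 pred1 (j + u - d).
  by move=> k; rewrite eBD_eq subr_eq addr_eq_sub.
rewrite (sum_two_eqs C0 (B0 0)) (sum_two_eqs C0 (B1 0)).
rewrite (sum_two_eqs C0 (B0 s)) (sum_two_eqs C0 (B1 s)) addr0.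
by rewrite (addrAC j s (- d)); ring.
Qed.

Lemma incidence_AD2_BC2 : (1 < p)%N -> incidence eAD2 eBC2 = p%:R.
Proof.
move=> p1; rewrite incidenceE !big_bool /tet_has /=.
rewrite !sumr_const !mul0rn !mulr0 !add0r mul1r card_ord.
by congr (_ *+ _); exact: Zp_cast.
Qed.

End Incidence.

(** * The determinant over the inner edges *)

Section InnerBlock.
Variables (R : realType) (m q n : nat).
Local Notation p := m.+2.
Local Notation K := (kept_indices p n).
Hypothesis np : (0 < n < p)%N.

Lemma inner_edgesE : inner_edges p q n =
  ((@eAB p @: K) :|: (@eCD p @: K)) :|: (((@eAC p @: K) :|: (@eBD p @: K)) :|:
    (((fun _ : unit => eAD2) @: [set: unit]) :|:
     ((fun _ : unit => eBC2) @: [set: unit]))).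
Proof.
have inner a : (a \in inner_edges p q n) =
    ~~ tet_has q (true, true, n%:R) a && ~~ tet_has q (true, true, p%:R) a.
  rewrite inE; apply/forall_inP/andP => [H|[Hn Hp] t].
    by split; apply: H; rewrite !inE eqxx ?orbT.
  by rewrite !inE => /orP[]/eqP->.
have notin (I : finType) (h : I -> edge p) (A : {set I}) (a : edge p) :
    (forall i, h i <> a) -> (a \in h @: A) = false.
  by move=> Nh; apply/imsetP => -[i _ E]; apply: (Nh i).
apply/setP=> a; rewrite inner /tet_has !in_setU.
have kept i : (i \in K) = ~~ (n%:R == i) && ~~ (p%:R == i).
  by rewrite !inE negb_or ![i == _]eq_sym.
have eABI : injective (@eAB p) by move=> ? ? [].
have eACI : injective (@eAC p) by move=> ? ? [].
have eBDI : injective (@eBD p) by move=> ? ? [].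
have eCDI : injective (@eCD p) by move=> ? ? [].
case: a => [i|i|i|i||||] /=.
- by rewrite mem_imset // !notin // !orbF kept !eAB_eq.
- by rewrite mem_imset // !notin // !orbF kept !eAC_eq.
- by rewrite mem_imset // !notin // !orbF kept !subr0 !eBD_eq.
- by rewrite mem_imset // !notin // !orbF kept !subr0 !eCD_eq.
- by rewrite !notin.
- by symmetry; apply/or3P/Or33/orP; left; apply/imsetP; exists tt.
- by rewrite !notin.
- by symmetry; apply/or3P/Or33/orP; right; apply/imsetP; exists tt.
Qed.

Lemma card_kept : #|K| = m.
Proof.
have := cardsC K; rewrite /kept_indices setCK cards2 card_ord pchar_Zp //.
by rewrite natZp_neq0 // addn2 => -[].
Qed.

Lemma pdet_unit (f : unit -> unit -> R) : pdet [set: unit] f = f tt tt.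
Proof.
rewrite (@pdet_enum _ _ _ 1 (fun=> tt)) ?det_mx11 ?mxE //.
- by move=> i j _; rewrite !ord1.
- by case; rewrite inE; apply/esym/codomP; exists 0.
Qed.

Lemma disjoint_kinds (A B : {set edge p}) :
    (forall a b, a \in A -> b \in B -> edge_kind a <> edge_kind b) ->
  [disjoint A & B].
Proof.
by move=> H; apply/pred0P=> x /=; apply/andP=> -[xA xB]; exact: H xA xB erefl.
Qed.

Lemma imsetU_kinds (I : finType) (h1 h2 : I -> edge p) (A : {set I}) k1 k2 :
    (forall i, edge_kind (h1 i) = k1) -> (forall i, edge_kind (h2 i) = k2) ->
  forall a, a \in h1 @: A :|: h2 @: A -> edge_kind a = k1 \/ edge_kind a = k2.
Proof. by move=> E1 E2 a /setUP[]/imsetP[i _ ->]; [left|right]. Qed.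

Let kindsB := @imsetU_kinds _ (@eAB p) (@eCD p) K _ _
  (fun=> erefl) (fun=> erefl).
Let kindsC := @imsetU_kinds _ (@eAC p) (@eBD p) K _ _
  (fun=> erefl) (fun=> erefl).
Let kindsD := @imsetU_kinds _ (fun=> @eAD2 p) (fun=> @eBC2 p) [set: unit] _ _
  (fun=> erefl) (fun=> erefl).

Lemma card_inner : #|inner_edges p q n| = (4 * m + 2)%N.
Proof.
have cardU (A B : {set edge p}) :
    (forall a b, a \in A -> b \in B -> edge_kind a <> edge_kind b) ->
    #|A :|: B| = (#|A| + #|B|)%N.
  by move=> /disjoint_kinds dAB; apply/eqP; rewrite (leq_card_setU A B).2.
have card2 (I : finType) (h1 h2 : I -> edge p) (A : {set I}) :
    injective h1 -> injective h2 ->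
    (forall i j, edge_kind (h1 i) <> edge_kind (h2 j)) ->
    #|(h1 @: A) :|: (h2 @: A)| = (#|A| + #|A|)%N.
  move=> i1 i2 h12; rewrite cardU ?card_imset //.
  by move=> a b /imsetP[i _ ->] /imsetP[j _ ->].
rewrite inner_edgesE cardU; last first.
  move=> a b /kindsB ka /setUP[/kindsC|/kindsD] kb;
    by case: ka => ->; case: kb => ->.
rewrite [X in (_ + X)%N]cardU; last first.
  by move=> a b /kindsC ka /kindsD kb; case: ka => ->; case: kb => ->.
rewrite !card2 //; try by [move=> ? ? [] | move=> [] []].
by rewrite card_kept cardsT card_unit; lia.
Qed.

(** Each pairing contributes the antidiagonal block matrix of a half-block and
    its transpose.  The signs of the first two pairings agree and cancel, so the
    sign is that of the 2 x 2 pairing of [eAD2] with [eBC2]. *)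
Lemma pdet_inner :
  pdet (inner_edges p q n) (@incidence R p q) =
  - (pdet K (fun i j => incidence R q (eAB i) (eCD j)) ^+ 2 *
     pdet K (fun i j => incidence R q (eAC i) (eBD j)) ^+ 2 * p%:R ^+ 2).
Proof.
rewrite inner_edgesE pdetU; first last.
- move=> a b /kindsB ka /setUP[/kindsC|/kindsD] kb;
    by apply: incidence_eq0; case: ka => ->; case: kb => ->.
- apply: disjoint_kinds => a b /kindsB ka /setUP[/kindsC|/kindsD] kb;
    by case: ka => ->; case: kb => ->.
rewrite [X in _ * X]pdetU; first last.
- move=> a b /kindsC ka /kindsD kb.
  by apply: incidence_eq0; case: ka => ->; case: kb => ->.
- apply: disjoint_kinds => a b /kindsC ka /kindsD kb.
  by case: ka => ->; case: kb => ->.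
rewrite !pdet_bipartite;
  try by [move=> *; rewrite incidence_eq0 | move=> *; exact: incidenceC
         | move=> ? ? [] | move=> [] []].
rewrite pdet_unit incidence_AD2_BC2 // cardsT card_unit expr1 mulN1r.
have := signrMK #|K| (1 : R); rewrite mulr1.
move: ((-1) ^+ _) (pdet _ _) (pdet _ _) => e x y ee.
by rewrite -[RHS]mul1r -ee; ring.
Qed.

End InnerBlock.

(** * Geometry of one tetrahedron *)

Section Geometry.
Variable R : realType.
Implicit Types (x y w : 'rV[R]_3) (P : vertex -> 'rV[R]_3).

Lemma dotE x y : dot x y = x 0 0 * y 0 0 + x 0 1 * y 0 1 + x 0 2%:R * y 0 2%:R.
Proof.
rewrite /dot !big_ord_recl big_ord0 addr0 addrA.
by congr (x 0 _ * y 0 _ + x 0 _ * y 0 _ + x 0 _ * y 0 _); apply: val_inj.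
Qed.

Lemma tripleE x y w : triple x y w =
  x 0 0 * (y 0 1 * w 0 2%:R - y 0 2%:R * w 0 1)
  - x 0 1 * (y 0 0 * w 0 2%:R - y 0 2%:R * w 0 0)
  + x 0 2%:R * (y 0 0 * w 0 1 - y 0 1 * w 0 0).
Proof.
rewrite /triple (expand_det_row _ 0) !big_ord_recl big_ord0 /cofactor.
rewrite !det_mx2 !mxE /=.
pose f (u : 'rV[R]_3) k : R := u 0 (inord k).
have fE (u : 'rV[R]_3) (i : 'I_3) : u 0 i = f u (val i) by rewrite /f inord_val.
by rewrite !fE /= /bump /=; ring.
Qed.

Lemma triple_gram x y w : triple x y w ^+ 2 =
  dot x x * dot y y * dot w w + 2 * dot x y * dot x w * dot y w
  - dot x x * dot y w ^+ 2 - dot y y * dot x w ^+ 2 - dot w w * dot x y ^+ 2.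
Proof. by rewrite tripleE !dotE; ring. Qed.

Lemma dot_ge0 x : 0 <= dot x x.
Proof. by rewrite dotE !addr_ge0 // -expr2 sqr_ge0. Qed.

Lemma dist_sqr x y : dist x y ^+ 2 = dot (x - y) (x - y).
Proof. by rewrite sqr_sqrtr ?dot_ge0. Qed.

Lemma distC x y : dist x y = dist y x.
Proof. by congr Num.sqrt; rewrite !dotE !mxE; ring. Qed.

(** Lagrange's identity. *)
Lemma cauchy_gap x y : 0 <= dot x x * dot y y - dot x y ^+ 2.
Proof.
have -> : dot x x * dot y y - dot x y ^+ 2 =
    (x 0 0 * y 0 1 - x 0 1 * y 0 0) ^+ 2 +
    (x 0 0 * y 0 2%:R - x 0 2%:R * y 0 0) ^+ 2 +
    (x 0 1 * y 0 2%:R - x 0 2%:R * y 0 1) ^+ 2 by rewrite !dotE; ring.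
by rewrite !addr_ge0 // sqr_ge0.
Qed.

(** The square of the sine of the dihedral angle at x, in terms of the volume:
    the left-hand side is |x|^4 times the product of the squared norms of the
    components of y and w orthogonal to x, and the square on the right is |x|^4
    times the square of the inner product of these components. *)
Lemma gram_pair_gap x y w :
  (dot x x * dot y y - dot x y ^+ 2) * (dot x x * dot w w - dot x w ^+ 2) =
  (dot x x * dot y w - dot x y * dot x w) ^+ 2 + dot x x * triple x y w ^+ 2.
Proof. by rewrite triple_gram; ring. Qed.

Lemma triple_dot_gt0 x y w : triple x y w != 0 -> 0 < dot x x.
Proof.
move=> v0; rewrite lt_def dot_ge0 andbT; apply: contraNneq v0 => x0.
have : triple x y w ^+ 2 <= 0.
  have := cauchy_gap x y; have := cauchy_gap x w.
  rewrite triple_gram x0 !mul0r !sub0r !oppr_ge0 => w0 y0.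
  have -> : dot x w = 0 by apply/eqP; rewrite -sqrf_eq0 eq_le w0 sqr_ge0.
  have -> : dot x y = 0 by apply/eqP; rewrite -sqrf_eq0 eq_le y0 sqr_ge0.
  by rewrite !(mulr0, mul0r, expr0n, addr0, subr0) /= ?mulr0 ?subr0.
by rewrite -sqrf_eq0 eq_le => ->; rewrite sqr_ge0.
Qed.

Lemma triple_dist_gt0 (M N S T : 'rV[R]_3) :
  triple (N - M) (S - M) (T - M) != 0 -> 0 < dist M N.
Proof. by move/triple_dot_gt0 => H; rewrite distC sqrtr_gt0. Qed.

(** The cosine of the dihedral angle is affine in the square of the length of
    the opposite edge, and by [gram_pair_gap] the sine of the angle is
    |MN| 6|V| / s, where s is the denominator of the cosine. *)
Lemma is_derive_dihedral_opposite (M N S T : 'rV[R]_3) :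
    triple (N - M) (S - M) (T - M) != 0 ->
  is_derive (dist S T) 1
    (dihedral (dist M N) (dist M S) (dist M T) (dist N S) (dist N T))
    (dist M N * dist S T / `|triple (N - M) (S - M) (T - M)|).
Proof.
set x := N - M; set y := S - M; set w := T - M; set v := triple x y w => v0.
have MN2 : dist M N ^+ 2 = dot x x by rewrite distC dist_sqr.
have MS2 : dist M S ^+ 2 = dot y y by rewrite distC dist_sqr.
have MT2 : dist M T ^+ 2 = dot w w by rewrite distC dist_sqr.
have gxy : (dist M N ^+ 2 + dist M S ^+ 2 - dist N S ^+ 2) / 2 = dot x y.
  by rewrite MN2 MS2 dist_sqr /x /y !dotE !mxE; field.
have gxw : (dist M N ^+ 2 + dist M T ^+ 2 - dist N T ^+ 2) / 2 = dot x w.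
  by rewrite MN2 MT2 dist_sqr /x /w !dotE !mxE; field.
have gyw : (dist M S ^+ 2 + dist M T ^+ 2 - dist S T ^+ 2) / 2 = dot y w.
  by rewrite MS2 MT2 dist_sqr /y /w !dotE !mxE; field.
pose gap1 := dot x x * dot y y - dot x y ^+ 2.
pose gap2 := dot x x * dot w w - dot x w ^+ 2.
have xx0 : 0 < dot x x := triple_dot_gt0 v0.
have gaps : gap1 * gap2 =
    (dot x x * dot y w - dot x y * dot x w) ^+ 2 + dot x x * v ^+ 2.
  exact: gram_pair_gap.
have v2 : 0 < v ^+ 2 by rewrite exprn_even_gt0.
have xv : 0 < dot x x * v ^+ 2 by rewrite mulr_gt0.
have gaps0 : 0 < gap1 * gap2 by rewrite gaps ltr_wpDl // sqr_ge0.
have gap10 : 0 < gap1.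
  rewrite lt_def cauchy_gap andbT; apply: contraTneq gaps0 => ->.
  by rewrite mul0r ltxx.
have gap20 : 0 < gap2.
  rewrite lt_def cauchy_gap andbT; apply: contraTneq gaps0 => ->.
  by rewrite mulr0 ltxx.
pose s := Num.sqrt gap1 * Num.sqrt gap2.
have s0 : 0 < s by rewrite mulr_gt0 ?sqrtr_gt0.
have s2 : s ^+ 2 = gap1 * gap2 by rewrite exprMn !sqr_sqrtr // ltW.
pose c (t : R) :=
  (dot x x * ((dot y y + dot w w - t ^+ 2) / 2) - dot x y * dot x w) / s.
have -> : dihedral (dist M N) (dist M S) (dist M T) (dist N S) (dist N T) =
    (@acos R) \o c.
  apply/funext => t; rewrite /dihedral gxy gxw MN2 MS2 MT2.
  by rewrite /c /s /gap1 /gap2.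
have cE : c (dist S T) = (dot x x * dot y w - dot x y * dot x w) / s.
  by rewrite /c -MS2 -MT2 gyw.
have sinE : 1 - c (dist S T) ^+ 2 = dot x x * v ^+ 2 / s ^+ 2.
  by rewrite cE expr_div_n s2 gaps; field; rewrite -gaps gt_eqF.
have sin0 : 0 < 1 - c (dist S T) ^+ 2 by rewrite sinE divr_gt0 // s2.
have c_lt1 : -1 < c (dist S T) < 1.
  by rewrite -ltr_norml -(@expr_lt1 _ 2) // real_normK ?num_real // -subr_gt0.
have dc : is_derive (dist S T) 1 c (- (dot x x * dist S T / s)).
  rewrite /c; apply: is_derive_eq.
  by rewrite /GRing.scale /=; field; rewrite gt_eqF.
have MN0 : 0 < dist M N by rewrite distC sqrtr_gt0.
apply: (is_derive_eq (is_derive1_comp (is_derive1_acos c_lt1) dc)).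
have -> : 1 - c (dist S T) ^+ 2 = (dist M N * `|v| / s) ^+ 2.
  rewrite sinE expr_div_n [(dist M N * _) ^+ 2]exprMn MN2.
  by rewrite real_normK ?num_real.
rewrite sqrtr_sqr ger0_norm; last first.
  by rewrite !mulr_ge0 ?invr_ge0 ?normr_ge0 // ltW.
rewrite -MN2; field.
by rewrite normr_eq0 v0 !gt_eqF.
Qed.

(** * Placements in general position *)

Lemma vol6_neq0 P : ~ coplanar P -> vol6 P vA vB vC vD != 0.
Proof.
move=> hP; apply/negP => v0; apply: hP.
move: v0; rewrite /vol6 /triple -det_tr => /det0P[u u0 uM].
exists u, (dot u (P vA)); split=> // X.
have row0 (j : 'I_3) :
    dot u (nth 0 [:: P vB - P vA; P vD - P vA; P vC - P vA] j) = 0.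
  have := congr1 (fun M : 'rV_3 => M 0 j) uM; rewrite !mxE => <-.
  by apply: eq_bigr => k _; rewrite !mxE.
have dotB (y w : 'rV[R]_3) : dot u (y - w) = dot u y - dot u w.
  by rewrite !dotE !mxE; ring.
apply/eqP; rewrite -subr_eq0 -dotB; case: X; apply/eqP.
- by rewrite subrr dotE !mxE; ring.
- exact: (row0 0).
- exact: (row0 2%:R).
- exact: (row0 1).
Qed.

Definition kind_length P (k : kind) : R :=
  let: (u, v) := ends k in dist (P u) (P v).

Definition kind_eq_dec (k k' : kind) : {k = k'} + {k <> k'}.
Proof. decide equality. Defined.

Definition change_length P (k : kind) (t : R) (k' : kind) : R :=
  if kind_eq_dec k' k then t else kind_length P k'.

Lemma is_derive_dihedral_at P (k : kind) : vol6 P vA vB vC vD != 0 ->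
  is_derive (kind_length P (opposite k)) 1
    (fun t => dihedral_at (change_length P (opposite k) t) k)
    (kind_length P k * kind_length P (opposite k) / `|vol6 P vA vB vC vD|).
Proof.
set v := vol6 _ _ _ _ _ => v0.
have H (m n r s : vertex) : vol6 P m n r s = v \/ vol6 P m n r s = - v ->
    is_derive (dist (P r) (P s)) 1
      (dihedral (dist (P m) (P n)) (dist (P m) (P r)) (dist (P m) (P s))
         (dist (P n) (P r)) (dist (P n) (P s)))
      (dist (P m) (P n) * dist (P r) (P s) / `|v|).
  move=> vE; have vE' : `|vol6 P m n r s| = `|v|.
    by case: vE => ->; rewrite ?normrN.
  have tE : triple (P n - P m) (P r - P m) (P s - P m) = - vol6 P m n r s.
    by rewrite /vol6 !tripleE; ring.
  rewrite -vE' -[`|vol6 _ _ _ _ _|]normrN -tE.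
  apply: is_derive_dihedral_opposite.
  by rewrite tE oppr_eq0 -normr_eq0 vE' normr_eq0.
case: k; rewrite /change_length /kind_length /=.
- by apply: (H vA vB vC vD); left.
- rewrite (distC (P vB) (P vC)); apply: (H vA vC vB vD); right.
  by rewrite /v /vol6 !tripleE !mxE; ring.
- rewrite (distC (P vB) (P vD)) (distC (P vC) (P vD)).
  apply: (H vA vD vB vC); left.
  by rewrite /v /vol6 !tripleE !mxE; ring.
- rewrite (distC (P vA) (P vB)) (distC (P vA) (P vC)).
  apply: (H vB vC vA vD); left.
  by rewrite /v /vol6 !tripleE !mxE; ring.
- rewrite (distC (P vA) (P vB)) (distC (P vA) (P vD)) (distC (P vC) (P vD)).
  apply: (H vB vD vA vC); right.
  by rewrite /v /vol6 !tripleE !mxE; ring.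
- rewrite (distC (P vA) (P vC)) (distC (P vB) (P vC)).
  rewrite (distC (P vA) (P vD)) (distC (P vB) (P vD)).
  apply: (H vC vD vA vB); left.
  by rewrite /v /vol6 !tripleE !mxE; ring.
Qed.

Lemma kind_length_gt0 P k : vol6 P vA vB vC vD != 0 -> 0 < kind_length P k.
Proof.
set v := vol6 _ _ _ _ _ => v0.
have H (m n r s : vertex) : vol6 P m n r s = v \/ vol6 P m n r s = - v ->
    0 < dist (P m) (P n).
  move=> vE; have : vol6 P m n r s != 0 by case: vE => ->; rewrite ?oppr_eq0.
  exact: triple_dist_gt0.
case: k; rewrite /kind_length /=.
- by apply: (H vA vB vC vD); left.
- by apply: (H vA vC vB vD); right; rewrite /v /vol6 !tripleE !mxE; ring.
- by apply: (H vA vD vB vC); left; rewrite /v /vol6 !tripleE !mxE; ring.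
- by apply: (H vB vC vA vD); left; rewrite /v /vol6 !tripleE !mxE; ring.
- by apply: (H vB vD vA vC); right; rewrite /v /vol6 !tripleE !mxE; ring.
- by apply: (H vC vD vA vB); left; rewrite /v /vol6 !tripleE !mxE; ring.
Qed.

End Geometry.

(** * Derivatives of the deficit angles *)

Section Curvature.
Variables (R : realType) (p q : nat) (P : vertex -> 'rV[R]_3).
Local Notation v := (vol6 P vA vB vC vD).
Hypothesis v0 : v != 0.
Local Notation len := (@placed_length R P p).

Lemma edge_kind_tet_edge (t : tetra p) k : edge_kind (tet_edge q t k) = k.
Proof. by case: t => [[[] []] i]; case: k. Qed.

Lemma tet_edge_eq (t : tetra p) (a : edge p) k :
  (tet_edge q t k == a) -> k = edge_kind a.
Proof. by move=> /eqP <-; rewrite edge_kind_tet_edge. Qed.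

Lemma len_gt0 a : 0 < len a.
Proof. exact: (kind_length_gt0 (edge_kind a) v0). Qed.

Lemma tet_vol6E (t : tetra p) : tet_vol6 P t = - tet_sign R t * v.
Proof.
case: t => [[up one] i]; rewrite /tet_sign /tet_vol6 /=; case: ifP => _.
  by rewrite /vol6 !tripleE !mxE; ring.
by rewrite opprK mul1r.
Qed.

Lemma sg_tet_vol6 (t : tetra p) :
  Num.sg (tet_vol6 P t) = - tet_sign R t * Num.sg v.
Proof.
rewrite tet_vol6E sgrM; congr (_ * _); rewrite /tet_sign.
by case: ifP => _; rewrite ?opprK ?sgrN sgr1.
Qed.

(** Since [t] has one edge of each kind, varying the length of [b] changes the
    edge of the kind of [b] in [t], or nothing. *)
Lemma dihedral_at_varied (t : tetra p) (b : edge p) k x :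
  dihedral_at ((fun c => if c == b then x else len c) \o tet_edge q t) k =
  if tet_has q t b then dihedral_at (change_length P (edge_kind b) x) k
  else dihedral_at (change_length P (edge_kind b) (len b)) k.
Proof.
rewrite -(fun_if (fun y => dihedral_at (change_length P (edge_kind b) y) k)).
congr dihedral_at; apply/funext => k' /=; rewrite /change_length.
case: kind_eq_dec => [kb|kb] /=.
  rewrite kb /tet_has; case: ifP => // _.
  by rewrite /placed_length edge_kind_tet_edge.
case: ifP => [/tet_edge_eq//|_].
by rewrite /placed_length edge_kind_tet_edge.
Qed.

(** As a function of one length, the deficit angle is a constant plus a multiple
    of a dihedral angle of ABCD; so it is constant where the multiplicity is
    zero. *)
Lemma omega_varied (a b : edge p) x :
  omega P q (fun c => if c == b then x else len c) a =
  Num.sg v * incidence R q a b *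
    (dihedral_at (change_length P (edge_kind b) x) (edge_kind a) -
     dihedral_at (change_length P (edge_kind b) (len b)) (edge_kind a)) +
  omega P q len a.
Proof.
have omega0 : omega P q len a =
    omega P q (fun c => if c == b then len b else len c) a.
  by congr omega; apply/funext => c; case: eqP => [->|].
rewrite omega0 /omega; set F := dihedral_at _ _; set G := dihedral_at _ _.
apply/eqP; rewrite -subr_eq opprK -sumrN -big_split /=; apply/eqP.
rewrite /incidence mulr_sumr mulr_suml big_mkcondr /=; apply: eq_bigr => t _.
rewrite sg_tet_vol6 !dihedral_at_varied -/F -/G.
by case: ifP => _; ring.
Qed.

Lemma domegaE (a b : edge p) :
  domega P q a b = len a * (incidence R q a b / v) * len b.
Proof.
rewrite /domega /partial derive1E.
have -> : (fun x => omega P q (fun c => if c == b then x else len c) a) =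
    (fun x => Num.sg v * incidence R q a b *
    (dihedral_at (change_length P (edge_kind b) x) (edge_kind a) -
     dihedral_at (change_length P (edge_kind b) (len b)) (edge_kind a)) +
    omega P q len a) by apply/funext => x; rewrite omega_varied.
set G := dihedral_at _ (edge_kind a); set o := omega _ _ _ _.
have [opp|nopp] := pselect (edge_kind b = opposite (edge_kind a)); last first.
  rewrite incidence_eq0 // (_ : (fun x => _) = cst o).
    by rewrite derive_cst mul0r mulr0 mul0r.
  by apply/funext => x /=; rewrite mulr0 mul0r add0r.
set c := _ * _; pose df := len a * len b / `|v|.
have dF : is_derive (len b) 1
    (fun x => dihedral_at (change_length P (edge_kind b) x) (edge_kind a)) df.
  by have := is_derive_dihedral_at (edge_kind a) v0; rewrite -opp; exact.
have dO : is_derive (len b) 1 (fun x => c *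
    (dihedral_at (change_length P (edge_kind b) x) (edge_kind a) - G) + o)
    (c * df).
  by apply: is_derive_eq; rewrite /GRing.scale /=; ring.
rewrite derive_val /c /df; rewrite {1}[v in RHS]numEsg invfM.
have sg2 : (Num.sg v)^-1 = Num.sg v.
  by case: sgrP v0 => //; rewrite ?invr1 // ?invrN1.
rewrite sg2; ring.
Qed.

End Curvature.

(** * The invariant *)

Section Invariant.
Variables (R : realType) (m q n : nat) (P : vertex -> 'rV[R]_3).
Local Notation p := m.+2.
Local Notation v := (vol6 P vA vB vC vD).
Local Notation K := (kept_indices p n).
Hypotheses (np : (0 < n < p)%N) (v0 : v != 0).

Lemma G3E (a b : edge p) : G3 P q a b = incidence R q a b.
Proof.
rewrite /G3 domegaE //; field.
by rewrite v0 !gt_eqF ?len_gt0.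
Qed.

Lemma s_numE :
  s_num P p q n = pdet K (fun i j => incidence R q (eAB i) (eCD j)).
Proof. by apply: eq_pdet => i j _ _; rewrite G3E. Qed.

Lemma t_numE :
  t_num P p q n = pdet K (fun i j => incidence R q (eAC i) (eBD j)).
Proof. by apply: eq_pdet => i j _ _; rewrite G3E. Qed.

Lemma det_f3E : det_f3 P p q n =
  - (s_num P p q n ^+ 2 * t_num P p q n ^+ 2 * p%:R ^+ 2) *
  ((\prod_(a in inner_edges p q n) placed_length P a ^+ 2) / v ^+ (4 * m + 2)).
Proof.
rewrite s_numE t_numE -pdet_inner // -(card_inner q np).
transitivity (pdet (inner_edges p q n) (fun a b =>
    (placed_length P a / v) * incidence R q a b * placed_length P b)).
  by apply: eq_pdet => a b _ _; rewrite domegaE //; ring.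
rewrite pdet_scale prodf_div prodr_const prodrXl; ring.
Qed.

Lemma prod_tet_sign : \prod_(t : tetra p) tet_sign R t = 1.
Proof.
pose F (x : bool * bool) (i : 'Z_p) : R := if x.1 == x.2 then 1 else -1.
rewrite -(pair_bigA _ F) /=.
rewrite -(pair_bigA _ (fun up one => \prod_(i : 'Z_p) F (up, one) i)) /=.
rewrite !big_bool /F /=.
by rewrite !prodr_const expr1n mul1r mulr1 -exprMn mulrNN mulr1 expr1n.
Qed.

Lemma prod_tet_vol6 :
  \prod_(t : tetra p | t \notin distinguished p n) (- tet_vol6 P t) =
  v ^+ (4 * m + 6).
Proof.
have volE (t : tetra p) : - tet_vol6 P t = tet_sign R t * v.
  by rewrite tet_vol6E mulNr opprK.
have distE : \prod_(t in distinguished p n) (- tet_vol6 P t) = v ^+ 2.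
  rewrite (eq_bigr (fun=> v)) => [|t]; last first.
    by rewrite !inE volE => /orP[]/eqP ->; rewrite mul1r.
  by rewrite prodr_const cards2 xpair_eqE eqxx /= pchar_Zp // natZp_neq0.
have allE : \prod_(t : tetra p) (- tet_vol6 P t) = v ^+ (4 * m + 8).
  rewrite (eq_bigr _ (fun t _ => volE t)) big_split /= prod_tet_sign mul1r.
  rewrite prodr_const !card_prod !card_bool card_ord; congr (_ ^+ _).
  by rewrite /Zp_trunc /=; lia.
apply: (mulfI (expf_neq0 2 v0)); rewrite -exprD -{1}distE.
rewrite -(bigID (mem (distinguished p n)) xpredT) /= allE.
by congr (_ ^+ _); lia.
Qed.

Lemma lens_invariantE : lens_invariant P p q n =
  quotient_or_infinity (- 1)
    (s_num P p q n ^+ 2 * t_num P p q n ^+ 2 * p%:R ^+ 2).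
Proof.
rewrite /lens_invariant /torsion det_f3E prod_tet_vol6.
set S := _ * p%:R ^+ 2; set L := \prod_(a in _) _.
have L0 : L != 0.
  by apply/prodf_neq0 => a _; rewrite expf_neq0 // gt_eqF ?len_gt0.
have Lv : L / v ^+ (4 * m + 2) != 0.
  by rewrite mulf_neq0 // invr_eq0 expf_neq0.
rewrite /quotient_or_infinity mulf_eq0 oppr_eq0 (negPf Lv) orbF.
case: eqP => //= /eqP S0.
congr Some; have -> : (4 * m + 6 = (4 * m + 2) + 4)%N by lia.
have w0 : v ^+ (4 * m + 2) != 0 by rewrite expf_neq0.
rewrite (exprD v (4 * m + 2) 4); move: (v ^+ (4 * m + 2)) w0 => w w0.
by field; rewrite S0 L0 v0 w0.
Qed.

End Invariant.

Theorem theorem9 (R : realType) (p q n qs : nat) (P : vertex -> 'rV[R]_3)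
    (hpq : coprime p q) (hq : (0 < q < p)%N) (hn : (0 < n < p)%N)
    (hqs : (0 < qs < p)%N) (hqqs : q * qs = n %[mod p])
    (hP : ~ coplanar P) :
  let s := s_num P p q n in
  let t := t_num P p q n in
  [/\ s%:C%C = n%:R * qs%:R - p%:R * nu R p q n qs,
      t = p%:R - s,
      t%:C%C = p%:R * (nu R p q n qs + 1) - n%:R * qs%:R
    & lens_invariant P p q n =
        quotient_or_infinity (- 1) (s ^+ 2 * t ^+ 2 * p%:R ^+ 2)].
Proof.
move=> s t; have v0 := vol6_neq0 hP.
case: p hpq hq hn hqs hqqs @s @t => [|[|m]] hpq hq hn hqs hqqs s t.
- by case/andP: hq.
- by case/andP: hq => q0; rewrite ltnS leqNgt q0.
have qU : (q%:R : 'Z_m.+2) \is a GRing.unit by rewrite unitZpE.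
have zP := @zeta_prim R m.+2 isT.
have sE : s%:C%C = lens_sum (zeta R m.+2) (n%:R : 'Z_m.+2) 1 q%:R.
  rewrite /s s_numE // -real_lens_sum ?unitr1 //; congr (_%:C%C).
  by apply: eq_pdet => i j _ _; rewrite incidence_AB_CD.
have tE : t%:C%C = lens_sum (zeta R m.+2) (n%:R : 'Z_m.+2) (- 1) q%:R.
  rewrite /t t_numE // -real_lens_sum ?unitrN1 //; congr (_%:C%C).
  by apply: eq_pdet => i j _ _; rewrite incidence_AC_BD.
have n0 := natZp_neq0 hn.
have nuE := p_mul_nu R hpq hn hqs hqqs.
have ts : t = m.+2%:R - s.
  by apply: (@complexI R); rewrite rmorphB /= rmorph_nat sE tE lens_sumN.
split=> //; last exact: lens_invariantE.
- by rewrite nuE sE; ring.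
- by rewrite mulrDr nuE mulr1 tE lens_sumN //; ring.
Qed.
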